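(* Let $a,b$ be relatively prime natural numbers and let $k\geq 2$ be an integer. If the multiplicative order of $b$ modulo $a$ is relatively prime to $k$, then there exist infinitely many natural numbers $n$ such that $n\equiv b \pmod a$ and $\sigma(n)$ is a perfect $k$th power.
   Context: $\sigma(n)$ denotes the sum of the positive divisors of $n$. Natural numbers are $\{1,2,3,\ldots\}$. The order of $b$ modulo $a$ is the least positive integer $t$ with $b^t\equiv 1 \pmod a$. *)

(* Defs.v *)
From mathcomp Require Import all_boot.
Set Implicit Arguments. Unset Strict Implicit. Unset Printing Implicit Defensive.

Definition sigma (n : nat) : nat := \sum_(d <- divisors n) d.

Definition is_mult_order (a b t : nat) : Prop :=
  [/\ 0 < t, b ^ t = 1 %[mod a] &
      forall s, 0 < s -> b ^ s = 1 %[mod a] -> t <= s].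

(* Main.v *)
(** Take n to be a product of distinct primes p with p = b mod a and p = -1 mod M, so that
    sigma(n) is the product of the numbers p + 1.  Every prime dividing some p + 1 with p <= x
    either divides M or is at most (x + 1) / M.  When M / phi(M) is large, the number of
    admissible p <= x therefore exceeds any prescribed multiple of the number r of primes that can
    divide the p + 1.  Dirichlet's theorem with density and Chebyshev-type bounds give this for
    some x.

    The exponents of the p + 1 modulo k are vectors in (Z/k)^r.  Since t is prime to k, a character
    of (Z/k)^r x (Z/t) that is nontrivial on the second factor takes a value other than 1 at every
    (v, 1).  Counting with characters then shows that the subsets with zero sum, of which there are
    at least 2^(N - O(r)), are equidistributed by size modulo t.  A zero-sum subset of size
    1 mod t yields n = b mod a with sigma(n) a k-th power.

    Dirichlet's theorem is obtained without complex characters, by an elementary argument in the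
    style of Shapiro in the space of real functions on the group of units: the obstruction is the
    projection of the indicator of 1 on the kernel of a normal operator, and positivity forces it
    to be 0 or a multiple of a real character chi with L(1, chi) = 0. *)

Require Import Defs.
From mathcomp Require Import all_boot all_order all_fingroup all_algebra all_field.
From mathcomp Require Import ring lra zify.
From mathcomp Require boolp classical_sets.
From mathcomp Require Import reals sequences exp Rstruct.
Import Order.TTheory GRing.Theory Num.Theory.
Set Implicit Arguments.
Unset Strict Implicit.
Unset Printing Implicit Defensive.

(** * Sums over divisors *)

(** Everything turns on comparing two logarithmic densities. The admissible primes form one class
    modulo a M, of density 1 / phi(a M); the primes q <= x / M, placed at the multiples M q <= x,
    have density of order 1 / M. The quotient M / (phi(a) phi(M)) is unbounded because the harmonic
    sum over the integers coprime to a diverges; M is kept coprime to a so that both congruences can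
    be imposed on p at once. The constant of the combinatorial step depends on k and t alone, so it
    is fixed before M, and M before x. Sums of ln p / p are controlled only up to O(1), which says
    nothing about prime counts at a given x; a good x is therefore found by contradiction, from an
    inequality between counts assumed at every x.

    The loss of 2^(O(r)) in the number of zero-sum subsets is harmless: a character that is
    nontrivial on the size contributes at most B^N with a fixed B < 2, and N is a large multiple of
    r. *)

Lemma gcdn_coprime_mul (d a b : nat) :
  coprime a b -> d %| a * b -> d = gcdn d a * gcdn d b.
Proof.
move=> cab dab; apply/eqP; rewrite eqn_dvd; apply/andP; split; last first.
  rewrite Gauss_dvd ?dvdn_gcdl //.
  by apply: coprime_dvdl (dvdn_gcdr d a) _; apply: coprime_dvdr (dvdn_gcdr d b) _.
rewrite muln_gcdl !muln_gcdr !dvdn_gcd dab.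
by rewrite dvdn_mulr // dvdn_mulr // dvdn_mull.
Qed.

Lemma divisors_coprime (a b : nat) : 0 < a -> 0 < b -> coprime a b ->
  perm_eq (divisors (a * b)) [seq d * e | d <- divisors a, e <- divisors b].
Proof.
move=> a0 b0 cab; have ab0 : 0 < a * b by rewrite muln_gt0 a0.
apply: uniq_perm (divisors_uniq _) _ _; last first.
  move=> d; rewrite -dvdn_divisors //; apply/idP/allpairsP.
    move=> dab; exists (gcdn d a, gcdn d b); rewrite -!dvdn_divisors //=.
    by rewrite !dvdn_gcdr; split=> //; exact: gcdn_coprime_mul.
  case=> -[x y] /=; rewrite -!dvdn_divisors // => -[xa yb ->].
  exact: dvdn_mul.
apply: allpairs_uniq (divisors_uniq _) (divisors_uniq _) _.
move=> [x y] [x' y'] /allpairsP[[u v] /= []]; rewrite -!dvdn_divisors // => ua vb [-> ->].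
move=> /allpairsP[[u' v'] /= []]; rewrite -!dvdn_divisors // => ua' vb' [-> ->] /= E.
have gcd_l w z : w %| a -> z %| b -> gcdn (w * z) a = w.
  move=> wa zb; rewrite gcdnC Gauss_gcdl; last by apply: coprime_dvdr zb _.
  by apply/gcdn_idPr.
have gcd_r w z : w %| a -> z %| b -> gcdn (w * z) b = z.
  move=> wa zb; rewrite gcdnC Gauss_gcdr; last by rewrite coprime_sym; apply: coprime_dvdl wa _.
  by apply/gcdn_idPr.
by congr pair; [rewrite -(gcd_l u v) // E gcd_l|rewrite -(gcd_r u v) // E gcd_r].
Qed.

Lemma divisors_pfactor (p a : nat) : prime p ->
  perm_eq (divisors (p ^ a)) [seq p ^ i | i <- iota 0 a.+1].
Proof.
move=> pp; apply: uniq_perm (divisors_uniq _) _ _.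
  rewrite map_inj_uniq ?iota_uniq // => i j /eqP.
  by rewrite eqn_exp2l ?prime_gt1 // => /eqP.
move=> d; rewrite -dvdn_divisors ?expn_gt0 ?prime_gt0 //.
apply/(dvdn_pfactor _ _ pp)/mapP=> -[i ia ->]; exists i => //.
  by rewrite mem_iota.
by move: ia; rewrite mem_iota.
Qed.

(** The induction suited to multiplicative functions: the full power of the least prime divisor is
    split off, which leaves two coprime factors. *)
Lemma prime_power_ind (P : nat -> Prop) : P 1 ->
  (forall p a n, prime p -> 0 < a -> 0 < n -> coprime (p ^ a) n -> P n -> P (p ^ a * n)) ->
  forall n, 0 < n -> P n.
Proof.
move=> P1 PX n; have [m] := ubnP n; elim: m n => // m IH n nm n0.
have [n1|n1] := leqP n 1; first by rewrite (_ : n = 1) //; case: n n0 n1 {nm} => [|[]].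
have pp := pdiv_prime n1; set p := pdiv n in pp.
have [n' cp nE] := pfactor_coprime pp n0.
have a0 : 0 < logn p n by rewrite logn_gt0 mem_primes pp n0 pdiv_dvd.
have n'0 : 0 < n' by case: n' nE {cp} => //; lia.
rewrite nE mulnC; apply: PX => //; first by rewrite coprime_pexpl.
apply: IH => //; rewrite -ltnS; apply: leq_trans nm; rewrite ltnS nE.
by rewrite -[X in X < _]muln1 ltn_pmul2l // -(exp1n (logn p n)) ltn_exp2r // prime_gt1.
Qed.

Section MultiplicativeSum.
Variables (R : comPzRingType) (f : nat -> R).
Hypothesis fM : forall a b, 0 < a -> 0 < b -> coprime a b -> f (a * b) = (f a * f b)%R.

Lemma sum_divisors_pfactor (p a n : nat) :
  prime p -> 0 < a -> 0 < n -> coprime (p ^ a) n ->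
  (\sum_(d <- divisors (p ^ a * n)) f d
     = (\sum_(i < a.+1) f (p ^ i)%N) * \sum_(d <- divisors n) f d)%R.
Proof.
move=> pp a0 n0 cp; have pa0 : 0 < p ^ a by rewrite expn_gt0 prime_gt0.
rewrite (perm_big _ (divisors_coprime pa0 n0 cp)) big_allpairs_dep /=.
transitivity (\sum_(d <- divisors (p ^ a)) f d * \sum_(e <- divisors n) f e)%R.
  rewrite !big_seq; apply: eq_bigr => d dpa; rewrite mulr_sumr !big_seq.
  apply: eq_bigr => e en.
  move: dpa en; rewrite -!dvdn_divisors // => dpa en.
  rewrite fM ?(dvdn_gt0 _ dpa) ?(dvdn_gt0 _ en) //.
  by apply: coprime_dvdl dpa _; apply: coprime_dvdr en _.
rewrite -mulr_suml (perm_big _ (divisors_pfactor a pp)) big_map.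
by rewrite -[iota 0 a.+1]/(index_iota 0 a.+1) big_mkord.
Qed.
End MultiplicativeSum.

Definition moebius (R : pzRingType) (n : nat) : R :=
  (if all (fun p => logn p n == 1) (primes n) then (-1) ^+ size (primes n) else 0)%R.

Lemma moebius1 (R : pzRingType) : moebius R 1 = 1%R.
Proof. by rewrite /moebius /= expr0. Qed.

Lemma moebiusM (R : comPzRingType) a b : 0 < a -> 0 < b -> coprime a b ->
  moebius R (a * b) = (moebius R a * moebius R b)%R.
Proof.
move=> a0 b0 cab.
have pE : perm_eq (primes (a * b)) (primes a ++ primes b).
  apply: uniq_perm (primes_uniq _) _ _; last by move=> p; rewrite mem_cat primesM.
  rewrite cat_uniq !primes_uniq andbT /=.
  by rewrite -coprime_has_primes // coprime_sym.
rewrite /moebius (perm_size pE) (perm_all _ pE) all_cat size_cat exprD.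
have -> : all (fun p => logn p (a * b) == 1) (primes a)
        = all (fun p => logn p a == 1) (primes a).
  apply: eq_in_all => p pa; rewrite lognM // (@logn_coprime p b) ?addn0 //.
  by apply: coprime_dvdl cab; move: pa; rewrite mem_primes => /and3P[].
have -> : all (fun p => logn p (a * b) == 1) (primes b)
        = all (fun p => logn p b == 1) (primes b).
  apply: eq_in_all => p pb; rewrite lognM // (@logn_coprime p a) //.
  by rewrite coprime_sym; apply: coprime_dvdr cab; move: pb; rewrite mem_primes => /and3P[].
by do 2![case: (all _ _)]; rewrite /= ?(mulr0, mul0r).
Qed.

Lemma moebius_pfactor (R : pzRingType) p a : prime p ->
  moebius R (p ^ a.+1) = (if a == 0 then -1 else 0)%R.
Proof.
move=> pp; rewrite /moebius primesX // primes_prime //= lognX.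
by rewrite logn_prime // eqxx muln1 andbT eqSS expr1.
Qed.

Lemma sum_moebius (R : comPzRingType) n : 0 < n ->
  (\sum_(d <- divisors n) moebius R d)%R = ((n == 1)%N%:R)%R.
Proof.
move: n; apply: prime_power_ind => [|p a n pp a0 n0 cp _].
  by rewrite big_seq1 moebius1.
rewrite (sum_divisors_pfactor (moebiusM R)) //.
case: a a0 cp => // a _ cp.
rewrite big_ord_recl big_ord_recl /= big1 ?addr0.
  rewrite moebius1 moebius_pfactor // subrr mul0r.
  case: eqP => // E; have : p %| 1 by rewrite -E expnS -mulnA dvdn_mulr.
  by rewrite dvdn1 => /eqP p1; rewrite p1 in pp.
by move=> i _; rewrite moebius_pfactor.
Qed.

Lemma sigma_coprime a b : 0 < a -> 0 < b -> coprime a b ->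
  sigma (a * b) = sigma a * sigma b.
Proof.
move=> a0 b0 cab; rewrite /sigma (perm_big _ (divisors_coprime a0 b0 cab)).
rewrite big_allpairs_dep /= big_distrlr /=.
by apply: eq_bigr => d _; apply: eq_bigr.
Qed.

Lemma sigma_prime p : prime p -> sigma p = p.+1.
Proof.
move=> pp; rewrite /sigma -[p in divisors p]expn1 (perm_big _ (divisors_pfactor 1 pp)).
by rewrite big_map /= !big_cons big_nil expn1 addn0.
Qed.

Lemma sigma_prod_primes (s : seq nat) : uniq s -> all prime s ->
  sigma (\prod_(p <- s) p) = \prod_(p <- s) p.+1.
Proof.
elim: s => [|p s IH] /=; first by rewrite !big_nil /sigma big_seq1.
move=> /andP[ps us] /andP[pp als]; rewrite !big_cons.
rewrite sigma_coprime ?(prime_gt0 pp) //; first by rewrite sigma_prime // IH.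
  by rewrite big_seq prodn_cond_gt0 // => q /(allP als)/prime_gt0.
rewrite big_seq; apply: (big_rec (fun z => coprime p z)); first exact: coprimen1.
move=> q z qs cz; rewrite coprimeMr cz andbT prime_coprime //.
by rewrite dvdn_prime2 ?(allP als q qs) //; apply: contraNneq ps => ->.
Qed.

Lemma perfect_power (k n : nat) : 0 < n -> (forall p, prime p -> k %| logn p n) ->
  exists m, n = m ^ k.
Proof.
move=> n0 kn; exists (\prod_(p <- primes n) p ^ (logn p n %/ k)).
rewrite {1}[n]prod_prime_decomp // prime_decompE big_map /=.
rewrite (big_morph (expn ^~ k) (fun a b => expnMn a b k) (exp1n k)).
rewrite !big_seq; apply: eq_bigr => p; rewrite mem_primes => /and3P[pp _ _].
by rewrite -expnM divnK // kn.
Qed.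

(** * Zero-sum subsets of prescribed size *)

Section ZeroSum.
Variables (k r : nat) (I : finType).
Implicit Types (v : I -> 'I_r -> nat) (S A : {set I}).

Definition zero_sum v S := [forall l, k %| \sum_(i in S) v i l].

Lemma zero_sum0 v : zero_sum v set0.
Proof. by apply/forallP => l; rewrite big_set0 dvdn0. Qed.

Section Characters.
Local Open Scope ring_scope.
Variable z : algC.
Hypotheses (k_gt0 : (0 < k)%N) (zP : k.-primitive_root z).
Implicit Types (c : {ffun 'I_r -> 'I_k}).

(** The character of (Z/k)^r with frequency [c], evaluated at the vector [v i]. *)
Definition zchar v c (i : I) : algC := z ^+ (\sum_l c l * v i l)%N.

Lemma sum_root_powers (s : nat) :
  \sum_(j < k) z ^+ (j * s) = if (k %| s)%N then k%:R else 0.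
Proof.
have zs : (k %| s)%N = (z ^+ s == 1) by rewrite -(prim_order_dvd zP).
rewrite zs; case: eqP => [zs1|zs1].
  under eq_bigr => j _ do rewrite mulnC exprM zs1 expr1n.
  by rewrite sumr_const card_ord.
have : (z ^+ s - 1) * \sum_(j < k) (z ^+ s) ^+ j = 0.
  by rewrite -subrX1 -exprM mulnC exprM (prim_expr_order zP) expr1n subrr.
move/eqP; rewrite mulf_eq0 subr_eq0; case: eqP => //= _ /eqP E.
by rewrite -[RHS]E; apply: eq_bigr => j _; rewrite mulnC exprM.
Qed.

Lemma sum_zchar (s : 'I_r -> nat) :
  \sum_(c : {ffun 'I_r -> 'I_k}) z ^+ (\sum_l c l * s l)%N
    = if [forall l, (k %| s l)%N] then (k ^ r)%:R else 0.
Proof.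
transitivity (\sum_(c : {ffun 'I_r -> 'I_k}) \prod_l z ^+ (c l * s l)).
  by apply: eq_bigr => c _; rewrite -expr_sum.
rewrite -(bigA_distr_bigA (fun (l : 'I_r) (j : 'I_k) => z ^+ (j * s l))).
under eq_bigr => l _ do rewrite sum_root_powers.
case: ifP => [/forallP H|/negbT].
  under eq_bigr => l _ do rewrite H.
  by rewrite prodr_const card_ord natrX.
rewrite negb_forall => /existsP[l /negbTE nl].
by rewrite (bigD1 l) //= nl mul0r.
Qed.

(** Expanding the product over subsets S produces the character at the sum of [v] over S, and
    orthogonality keeps the zero-sum S. The weights [b] are free: one choice makes every product on
    the left vanish, another records the size of S. *)
Lemma sum_prod_zchar v (b : I -> algC) :
  \sum_c \prod_i (1 + b i * zchar v c i)
    = (k ^ r)%:R * \sum_(S : {set I} | zero_sum v S) \prod_(i in S) b i.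
Proof.
under eq_bigr => c _.
  under eq_bigr => i _ do rewrite addrC.
  rewrite bigA_distr /=.
  under eq_bigr => S _.
    rewrite -big_mkcond /= big_split /= -expr_sum exchange_big /=.
    under [X in z ^+ X]eq_bigr => l _ do rewrite -big_distrr /=.
  over.
over.
rewrite exchange_big /= mulr_sumr [RHS]big_mkcond /=.
apply: eq_bigr => S _; rewrite -mulr_sumr sum_zchar -/(zero_sum v S).
by case: ifP => _; rewrite ?mulr0 // mulrC.
Qed.

(* Killing, at each step, the most popular value at v i among the remaining characters removes at
   least 1/k of them. *)
Lemma kill_characters v (s : seq I) : uniq s ->
  exists a : I -> algC,
    (#|[set c | all (fun i => (a i * zchar v c i != 1)%R) s]| * k ^ size s
      <= k.-1 ^ size s * k ^ r)%N.
Proof.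
elim: s => [|i s IH] /=.
  move=> _; exists (fun=> 0); rewrite !muln1 mul1n.
  by rewrite -[X in (X ^ _)%N]card_ord -[X in (_ ^ X)%N]card_ord -card_ffun max_card.
move=> /andP[is_ /IH[a Ha]].
set X := [set c | _] in Ha.
pose e c : 'I_k := Ordinal (ltn_pmod (\sum_l c l * v i l)%N k_gt0).
have [j Hj] : exists j : 'I_k, (#|X| <= k * #|[set c in X | e c == j]|)%N.
  apply/existsP; apply: contraT; rewrite negb_exists => /forallP H.
  have : (\sum_(j < k) (k * #|[set c in X | e c == j]|).+1 <= \sum_(j < k) #|X|)%N.
    by apply: leq_sum => j _; rewrite ltnNge H.
  under eq_bigr => j _ do rewrite -addn1.
  rewrite big_split /= -big_distrr /= !sum_nat_const card_ord muln1.
  have -> : (\sum_(j < k) #|[set c in X | e c == j]| = #|X|)%N.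
    rewrite -sum1_card (partition_big e xpredT) //=.
    by apply: eq_bigr => j _; rewrite -sum1_card; apply: eq_bigl => c; rewrite inE.
  by rewrite -[X in (_ <= X)%N]addn0 leq_add2l leqn0 eqn0Ngt k_gt0.
exists (fun x => if x == i then (z ^+ j)^-1 else a x).
set Y := [set c | _].
have zj0 : z ^+ j != 0.
  apply/eqP => E; have := prim_expr_order zP.
  rewrite -[k in z ^+ k](subnK (ltnW (ltn_ord j))) exprD E mulr0 => /eqP.
  by rewrite eq_sym oner_eq0.
have YX : Y \subset X :\: [set c in X | e c == j].
  apply/subsetP => c; rewrite !inE eqxx => /andP[ci cs].
  have -> /= : all (fun i0 => a i0 * zchar v c i0 != 1) s.
    apply/allP => x xs; have := allP cs x xs; case: (x =P i) => // xi.
    by move: is_; rewrite -xi xs.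
  rewrite andbT; apply: contraNneq ci => ej.
  have <- : z ^+ j = zchar v c i by rewrite -ej /= (prim_expr_mod zP).
  by rewrite mulVf.
have YE : (#|Y| + #|[set c in X | e c == j]| <= #|X|)%N.
  rewrite -(cardsID [set c in X | e c == j] X) addnC leq_add //; last exact: subset_leq_card.
  by apply/subset_leq_card/subsetP=> c; rewrite !inE => /andP[-> ->].
have : (k * #|Y| <= k.-1 * #|X|)%N.
  move: Hj YE (prednK k_gt0); set x := #|X|; set y := #|Y|; set u := #|_|.
  move: (k.-1) => q; nia.
move=> H1; rewrite !expnS mulnCA !mulnA.
apply: leq_trans (leq_mul H1 (leqnn (k ^ size s))) _.
by rewrite -!mulnA leq_mul2l Ha orbT.
Qed.

End Characters.

(** Under this inequality [kill_characters] leaves no character, so the product of 1 - a i chi(v i)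
    over A vanishes for every chi. In [sum_prod_zchar] the empty set contributes 1 to a total of 0,
    so another zero-sum set must occur. *)
Lemma zero_sum_subset v A : 0 < k -> k.-1 ^ #|A| * k ^ r < k ^ #|A| ->
  exists S, [/\ S \subset A, S != set0 & zero_sum v S].
Proof.
move=> k0 hA; have [z zP] := C_prim_root_exists k0.
have [a Ha] := kill_characters k0 zP v (enum_uniq A).
rewrite -cardE in Ha.
have X0 : #|[set c | all (fun i => (a i * zchar z v c i != 1)%R) (enum A)]| = 0.
  by apply/eqP; rewrite -leqn0; have := leq_ltn_trans Ha hA; case: #|_| => // n; nia.
move/eqP: X0; rewrite cards_eq0 => /eqP X0.
suff /existsP[S /and3P[? ? ?]] :
  [exists S : {set I}, [&& S \subset A, S != set0 & zero_sum v S]] by exists S.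
apply: contraT; rewrite negb_exists => /forallP H.
(* The zero weights outside [A] remove the subsets not contained in [A]. *)
have := sum_prod_zchar zP v (fun i => if i \in A then (- a i)%R else 0%R).
rewrite big1 => [|c _]; last first.
  have : c \notin [set c | all (fun i => (a i * zchar z v c i != 1)%R) (enum A)].
    by rewrite X0 inE.
  rewrite inE => /allPn[i]; rewrite mem_enum => iA; rewrite negbK => /eqP E.
  by rewrite (bigD1 i) //= iA mulNr E subrr mul0r.
rewrite (bigD1 set0) ?zero_sum0 //= big_set0 big1 ?addr0 ?mulr1.
  by move/esym/eqP; rewrite pnatr_eq0 expn_eq0; case: (k) k0.
move=> S /andP[zS S0]; have := H S; rewrite S0 zS !andbT => /subsetPn[i iS iA].
by rewrite (bigD1 i) //= (negbTE iA) mul0r.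
Qed.

(* Negating the values on a zero-sum set T turns S into the symmetric difference of S and T. *)
Lemma card_zero_sum_subsets D v A : 0 < k ->
  (forall v (B : {set I}), D <= #|B| -> exists S, [/\ S \subset B, S != set0 & zero_sum v S]) ->
  2 ^ #|A| <= #|[set S in powerset A | zero_sum v S]| * 2 ^ D.
Proof.
move=> k0 HD; have [n] := ubnP #|A|; elim: n A v => // n IH A v nA.
have [DA|AD] := leqP D #|A|; last first.
  apply: leq_trans (_ : 1 * 2 ^ D <= _).
    by rewrite mul1n leq_exp2l // ltnW.
  rewrite leq_mul2r; apply/orP; right; rewrite card_gt0; apply/set0Pn; exists set0.
  by rewrite !inE sub0set zero_sum0.
have [T [TA T0 zT]] := HD v A DA.
have [x xT] := set0Pn _ T0; have xA := subsetP TA x xT.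
pose v' i l := if i \in T then k.-1 * v i l else v i l.
have c1 : #|A :\ x| < n by move: nA; rewrite (cardsD1 x) xA.
have h1 := IH (A :\ x) v c1; have h2 := IH (A :\ x) v' c1.
rewrite (cardsD1 x) xA add1n expnS.
pose Z1 := [set S in powerset (A :\ x) | zero_sum v S].
pose Z2 := [set S in powerset (A :\ x) | zero_sum v' S].
(* [Z1] consists of sets avoiding [x]; as [x] lies in [T], the images of [Z2] under [f] all contain
   [x]. These two disjoint families double the bound known for [A :\ x]. In [v'] the factor [k.-1]
   stands for -1 modulo [k]. *)
pose f S := (S :\: T) :|: (T :\: S).
have fK : involutive f.
  move=> S; apply/setP => i; rewrite !inE.
  by case: (i \in S); case: (i \in T).
have sub : Z1 :|: f @: Z2 \subset [set S in powerset A | zero_sum v S].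
  apply/subsetP => S; rewrite in_setU => /orP[].
    by rewrite !inE => /andP[/subset_trans -> //]; rewrite ?subD1set.
  case/imsetP => S'; rewrite !inE => /andP[SA zS] ->; apply/andP; split.
    apply/subsetP => i; rewrite !inE => /orP[/andP[_ iS]|/andP[_ iT]].
      by have := subsetP SA i iS; rewrite !inE => /andP[].
    exact: (subsetP TA).
  apply/forallP => l; have := forallP zS l; have := forallP zT l.
  rewrite (big_setID S') (setIC T) /= => hT.
  rewrite (big_setID T) /= [in X in X -> _]addnC.
  rewrite (@eq_bigr _ _ _ _ _ _ (fun i => v' i l) (fun i => v i l)); last first.
    by move=> i; rewrite inE /v' => /andP[/negbTE ->].
  rewrite (@eq_bigr _ _ _ _ _ _ (fun i => v' i l) (fun i => k.-1 * v i l)); last first.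
    by move=> i; rewrite inE /v' => /andP[_ ->].
  rewrite -big_distrr /= => hS.
  rewrite (big_setID T) /=.
  have -> : f S' :&: T = T :\: S'.
    by apply/setP => i; rewrite !inE; case: (i \in S'); case: (i \in T).
  have -> : f S' :\: T = S' :\: T.
    by apply/setP => i; rewrite !inE; case: (i \in S'); case: (i \in T).
  move: hT hS; case: (k) k0 => // m _ /=.
  set a := \sum_(_ in _) _; set b := \sum_(_ in _) _; set c := \sum_(_ in _) _.
  move=> h1' h2'; have := dvdn_add h1' h2'.
  have -> : a + b + (c + m * a) = m.+1 * a + (b + c) by nia.
  by rewrite dvdn_addr // dvdn_mulr.
have dis : [disjoint Z1 & f @: Z2].
  rewrite -setI_eq0; apply/eqP/setP => S; rewrite !inE; apply/negbTE.
  apply/negP => /andP[/andP[SA _] /imsetP[S']]; rewrite !inE => /andP[S'A _] E.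
  have xS : x \notin S by apply/negP => /(subsetP SA); rewrite !inE eqxx.
  have xS' : x \notin S' by apply/negP => /(subsetP S'A); rewrite !inE eqxx.
  by move: xS; rewrite E !inE xT xS'.
have := subset_leq_card sub.
rewrite cardsU (_ : Z1 :&: f @: Z2 = set0); last by apply/eqP; rewrite setI_eq0.
rewrite cards0 subn0 card_imset; last exact: inv_inj.
move: h1 h2; rewrite -/Z1 -/Z2 => h1 h2 h3.
have := leq_mul h3 (leqnn (2 ^ D)); nia.
Qed.

End ZeroSum.

(** Bernoulli's inequality: the power of 1 + 1/(k-1) with exponent k (k-1) is at least 1 + k. Hence
    a number of elements proportional to the number of coordinates meets the hypothesis of
    [zero_sum_subset]. *)
Lemma exp_pred_bound k : 1 < k -> k.-1 ^ (k * k.-1) * k < k ^ (k * k.-1).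
Proof.
case: k => // -[|m] // _ /=; set e := m.+2 * m.+1.
have H j : m.+1 ^ j * (m.+1 + j) <= m.+2 ^ j * m.+1.
  elim: j => [|j IH]; first by rewrite !expn0; nia.
  rewrite !expnS; nia.
have := H e; rewrite (_ : m.+1 + e = (m.+3) * m.+1); last by rewrite /e; nia.
by rewrite mulnA leq_mul2r /= => h; apply: leq_trans h; rewrite ltn_mul2l expn_gt0 ltnS leqnn.
Qed.

(** * Roots of unity at a distance from 1 *)

Section UnitCircle.
Local Open Scope ring_scope.

Lemma norm_add1_root (n : nat) (u : algC) :
  (0 < n)%N -> u ^+ n = 1 -> u != 1 -> `|1 + u| < 2.
Proof.
move=> n0 un u1.
have nu : `|u| = 1.
  by apply/eqP; rewrite -(@pexpr_eq1 _ _ n) // -normrX un normr1.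
rewrite lt_neqAle; apply/andP; split; last first.
  by apply: le_trans (ler_normD _ _) _; rewrite nu normr1.
apply: contraNneq u1 => E.
have /normCDeq[t _ []] : `|1 + u| = `|1| + `|u| :> algC.
  by rewrite nu normr1 E.
by rewrite normr1 nu !mul1r => <- ->.
Qed.

(** The powers of [w] take finitely many values, so the strict bound of [norm_add1_root] becomes
    uniform. *)
Lemma norm_add1_roots (n : nat) (w : algC) : (0 < n)%N -> w ^+ n = 1 ->
  exists2 B : algC, 0 <= B < 2 & forall m, w ^+ m != 1 -> `|1 + w ^+ m| <= B.
Proof.
move=> n0 wn.
suff [B B2 HB] : exists2 B : algC, 0 <= B < 2 &
    forall m, (m < n)%N -> w ^+ m != 1 -> `|1 + w ^+ m| <= B.
  exists B => // m; have := divn_eq m n.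
  move=> -> ; rewrite exprD mulnC exprM wn expr1n mul1r.
  by apply: HB; rewrite ltn_pmod.
elim: {1}n => [|q [B /andP[B0 B2] HB]].
  by exists 0 => //; rewrite lexx ltr0n.
have [w1|w1] := eqVneq (w ^+ q) 1.
  exists B; rewrite ?B0 // => m; rewrite ltnS leq_eqVlt => /orP[/eqP -> |]; last exact: HB.
  by rewrite w1 eqxx.
have [h|h] := real_leP (normr_real (1 + w ^+ q)) (ger0_real B0).
  by exists B; rewrite ?B0 // => m; rewrite ltnS leq_eqVlt => /orP[/eqP -> |/HB].
exists `|1 + w ^+ q|.
  rewrite normr_ge0 (norm_add1_root n0) //.
  by rewrite -exprM mulnC exprM wn expr1n.
move=> m; rewrite ltnS leq_eqVlt => /orP[/eqP -> //|mq wm].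
by apply: le_trans (HB _ mq wm) (ltW h).
Qed.

Lemma exp_lt_inv (R : archiNumFieldType) (b B : R) : 0 <= b < 1 -> 0 <= B ->
  exists C, b ^+ C * B < 1.
Proof.
move=> /andP[b0 b1] B0; have d0 : 0 < 1 - b by rewrite subr_gt0.
have H n : b ^+ n * (1 + n%:R * (1 - b)) <= 1.
  elim: n => [|n IH]; first by rewrite expr0 mul0r addr0 mulr1.
  have -> : b ^+ n.+1 * (1 + n.+1%:R * (1 - b))
      = b * (b ^+ n * (1 + n%:R * (1 - b))) + b ^+ n.+1 * (1 - b).
    by rewrite exprS -natr1; ring.
  rewrite [leRHS](_ : 1 = b * 1 + 1 * (1 - b)); last by ring.
  apply: lerD; first exact: ler_wpM2l.
  by apply: (ler_wpM2r (ltW d0)); apply: exprn_ile1 => //; apply: ltW.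
have := archi_boundP (divr_ge0 B0 (ltW d0)); set C := Num.Def.archi_bound _.
rewrite ltr_pdivrMr // => HC; exists C; have := H C; have := exprn_ge0 C b0.
rewrite le_eqVlt => /orP[/eqP <-|p0]; first by rewrite !mul0r ltr01.
apply: lt_le_trans; rewrite ltr_pM2l // (lt_trans HC) //.
by rewrite ltrDr ltr01.
Qed.

End UnitCircle.

(** With N elements there are at least 2^(N - e (r+1)) zero-sum sets, while failure of the claim
    would force at most t B^N of them. [C] is chosen with (B/2)^C 2^e t < 1; the (r+1)-th power of
    this inequality contradicts the two bounds for every [r]. *)
Lemma zero_sum_mod (k t : nat) : 1 < k -> 0 < t -> coprime k t ->
  exists C, forall r (I : finType) (v : I -> 'I_r -> nat), C * r.+1 <= #|I| ->
    exists2 S : {set I}, zero_sum k v S & #|S| = 1 %[mod t].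
Proof.
(* One root [w] of order k t serves both factors: [z] and [zt], of orders k and t, are powers of it,
   so a single bound [B] covers all the characters. *)
move=> k1 t0 ckt; have k0 := ltnW k1; pose K := k * t.
have K0 : 0 < K by rewrite muln_gt0 k0.
have [w wP] := C_prim_root_exists K0.
have [B /andP[B0 B2] HB] := norm_add1_roots K0 (prim_expr_order wP).
have [e eP] : exists e, k.-1 ^ e * k < k ^ e by exists (k * k.-1); apply: exp_pred_bound.
have [C HC] : exists C, ((B / 2) ^+ C * (2 ^ e * t)%:R < 1)%R.
  apply: exp_lt_inv; rewrite ?ler0n //.
  by rewrite divr_ge0 //= ltr_pdivrMr ?mul1r.
exists C => r I v hI; pose z := (w ^+ t)%R; pose zt := (w ^+ k)%R.
have zP : (k.-primitive_root z)%R.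
  have := exp_prim_root wP t; rewrite /K gcdnC gcdnC.
  by rewrite (gcdn_idPl (dvdn_mull k (dvdnn t))) mulnK.
have ztP : (t.-primitive_root zt)%R.
  have := exp_prim_root wP k.
  by rewrite (gcdn_idPl (dvdn_mulr t (dvdnn k))) mulKn.
pose D := e * r.+1.
have HD (v' : I -> 'I_r -> nat) (A : {set I}) : D <= #|A| ->
    exists S : {set I}, [/\ S \subset A, S != set0 & zero_sum k v' S].
  move=> DA; have [U UA cU] : exists2 U : {set I}, U \subset A & #|U| = D.
    have /card_geqP[s [us ss sA]] := DA.
    exists [set x in s]; first by apply/subsetP => x; rewrite inE => /sA.
    by rewrite cardsE (card_uniqP us).
  have [|S [SU S0 zS]] := @zero_sum_subset k r I v' U k0.
    rewrite cU /D !expnM; apply: leq_ltn_trans (_ : (k.-1 ^ e * k) ^ r.+1 < _).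
      by rewrite expnMn leq_mul2l leq_exp2l // leqnSn orbT.
    by rewrite ltn_exp2r.
  by exists S; split=> //; apply: subset_trans UA.
have cnt := card_zero_sum_subsets v [set: I] k0 HD.
suff /existsP[S /andP[zS /eqP cS]] :
  [exists S : {set I}, zero_sum k v S && (#|S| == 1 %[mod t])] by exists S.
apply: contraT; rewrite negb_exists => /forallP H.
(* The Fourier coefficients, over Z/t, of the number of zero-sum sets as a function of their size. *)
pose Z j := (\sum_(S : {set I} | zero_sum k v S) zt ^+ (j * #|S|))%R.
have Zbound j : 0 < j < t -> (`|Z j| <= B ^+ #|I|)%R.
  move=> /andP[j0 jt].
  have kr0 : (0 < (k ^ r)%:R :> algC)%R by rewrite ltr0n expn_gt0 k0.
  rewrite -(ler_pM2l kr0) -[X in (X * `|_| <= _)%R](ger0_norm (ltW kr0)) -normrM.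
  have -> : ((k ^ r)%:R * Z j = \sum_(c : {ffun 'I_r -> 'I_k}) \prod_i (1 + zt ^+ j * zchar z v c i))%R.
    rewrite (sum_prod_zchar zP); congr (_ * _)%R; apply: eq_bigr => S _.
    by rewrite prodr_const exprM.
  apply: le_trans (ler_norm_sum _ _ _) _.
  apply: (@le_trans _ _ (\sum_(c : {ffun 'I_r -> 'I_k}) B ^+ #|I|)%R); last first.
    by rewrite sumr_const card_ffun !card_ord mulr_natl lexx.
  apply: ler_sum => c _; rewrite normr_prod -[#|I|]/#|(xpredT : pred I)| -prodr_const.
  apply: ler_prod => i _; rewrite normr_ge0 /= /zchar -!exprM -exprD.
  (* If w^(k j + t y) were 1, then t would divide k j, hence j by coprimality, contrary to 0 < j <
     t. *)
  apply: HB; set y := (\sum_l _)%N.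
  rewrite -(prim_order_dvd wP); apply/negP => dK.
  have : t %| k * j + t * y by apply: dvdn_trans dK; apply: dvdn_mull.
  rewrite (dvdn_addl _ (dvdn_mulr y (dvdnn t))) Gauss_dvdr 1?coprime_sym // => /(dvdn_leq j0).
  by rewrite leqNgt jt.
(* Fourier inversion at size 1: the sum is t times the number of zero-sum sets of size 1 modulo t,
   and [t.-1] stands for -1 in the exponent. *)
have S0 : (\sum_(j < t) zt ^+ (j * t.-1) * Z j = 0)%R.
  under eq_bigr => j _ do rewrite mulr_sumr.
  rewrite exchange_big /= big1 // => S zS.
  under eq_bigr => j _ do rewrite -exprD -mulnDr.
  rewrite (sum_root_powers ztP) ifN //.
  have := H S; rewrite zS /=; apply: contra => /dvdnP[q E].
  have E2 : #|S| + t = q * t + 1 by move: E (prednK t0); lia.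
  by apply/eqP; rewrite -modnDr E2 modnMDl.
have Z0 : Z 0 = (#|[set S in powerset [set: I] | zero_sum k v S]|%:R)%R.
  rewrite /Z -sum1_card natr_sum; apply: eq_big => [S|S _]; last by rewrite mul0n expr0.
  by rewrite !inE subsetT.
move: S0; rewrite (bigD1 (Ordinal t0)) //= mul0n expr0 mul1r Z0 => /eqP.
rewrite addr_eq0 => /eqP /(congr1 (fun x => `|x|%R)); rewrite normrN normr_nat => E.
have : (#|[set S in powerset [set: I] | zero_sum k v S]|%:R <= t%:R * B ^+ #|I| :> algC)%R.
  rewrite E; apply: le_trans (ler_norm_sum _ _ _) _.
  apply: (@le_trans _ _ (\sum_(j < t) B ^+ #|I|)%R); last first.
    by rewrite sumr_const card_ord mulr_natl lexx.
  rewrite [X in (_ <= X)%R](bigD1 (Ordinal t0)) //=.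
  apply: ler_wpDl; first by rewrite exprn_ge0.
  apply: ler_sum => j j0; rewrite normrM normrX.
  have -> : `|zt|%R = 1%R.
    apply/eqP; rewrite -(@pexpr_eq1 _ _ t) // -normrX.
    by rewrite (prim_expr_order ztP) normr1.
  rewrite expr1n mul1r; apply: Zbound; rewrite ltn_ord andbT lt0n.
  by apply: contraNneq j0 => j0; apply/eqP/val_inj.
move: cnt; rewrite cardsT; set N := #|I| in hI *; set n := #|_| => cnt nB.
have : (1 <= (B / 2) ^+ N * (2 ^ D * t)%:R)%R.
  rewrite expr_div_n mulrAC ler_pdivlMr ?exprn_gt0 ?ltr0n // mul1r.
  rewrite -natrX; apply: (@le_trans _ _ (n * 2 ^ D)%:R%R); first by rewrite ler_nat.
  by rewrite natrM natrM [X in (_ <= X)%R]mulrC -mulrA [X in (_ <= X)%R]mulrC ler_wpM2r ?ler0n.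
move=> h1; suff /(le_lt_trans h1) : ((B / 2) ^+ N * (2 ^ D * t)%:R < 1)%R by rewrite ltxx.
move=> {h1}.
have b01 : (0 <= B / 2 <= 1)%R by rewrite divr_ge0 //= ler_pdivrMr ?mul1r ?ltW.
apply: (@le_lt_trans _ _ (((B / 2) ^+ C * (2 ^ e * t)%:R) ^+ r.+1)%R); last first.
  by rewrite exprn_ilt1 // mulr_ge0 ?ler0n ?exprn_ge0 //; case/andP: b01.
rewrite [X in (_ <= X)%R]exprMn -exprM -natrX; apply: ler_pM.
- by rewrite exprn_ge0 //; case/andP: b01.
- by rewrite ler0n.
- by case/andP: b01 => ? ?; rewrite ler_wiXn2l.
by rewrite ler_nat expnMn /D expnM leq_mul2l -[X in X <= _]expn1 leq_pexp2l ?orbT.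
Qed.

(** * Estimates of Chebyshev and Mertens *)

Local Open Scope ring_scope.

Lemma sum_multiples (V : nmodType) (d x : nat) (f : nat -> V) : (0 < d)%N ->
  \sum_(1 <= n < x.+1 | (d %| n)%N) f (n %/ d)%N = \sum_(1 <= e < (x %/ d).+1) f e.
Proof.
move=> d0; elim: x => [|x IH]; first by rewrite div0n !big_geq.
rewrite big_mkcond big_nat_recr //= -big_mkcond IH divnS //.
case: (d %| x.+1)%N; last by rewrite /= add0n addr0.
by rewrite /= add1n [RHS]big_nat_recr.
Qed.

Lemma sum_divisors_exchange (V : nmodType) (x : nat) (F : nat -> nat -> V) :
  \sum_(1 <= n < x.+1) \sum_(d <- divisors n) F d (n %/ d)%N
  = \sum_(1 <= d < x.+1) \sum_(1 <= e < (x %/ d).+1) F d e.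
Proof.
transitivity (\sum_(1 <= n < x.+1) \sum_(1 <= d < x.+1 | (d %| n)%N) F d (n %/ d)%N).
  apply: eq_big_nat => n /andP[n0 nx]; rewrite -[RHS]big_filter; apply: perm_big.
  apply: uniq_perm; rewrite ?divisors_uniq ?filter_uniq ?iota_uniq // => d.
  rewrite -dvdn_divisors // mem_filter mem_index_iota.
  case dn: (d %| n)%N => //=; rewrite (dvdn_gt0 n0 dn) /=.
  by rewrite (leq_ltn_trans (dvdn_leq n0 dn) nx).
rewrite (exchange_big_dep xpredT) //=; apply: eq_big_nat => d /andP[d0 _].
by rewrite (sum_multiples _ (F d)).
Qed.

Section RealSums.
Variable R : realType.
Implicit Types (f w : nat -> R) (n x : nat).

Lemma abel_summation f w (a b : nat) : (a <= b)%N ->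
  \sum_(a <= n < b) f n * w n
  = (\sum_(a <= n < b) f n) * w b
    + \sum_(a <= n < b) (\sum_(a <= i < n.+1) f i) * (w n - w n.+1).
Proof.
move=> ab; rewrite -(subnKC ab); elim: (b - a)%N => [|j IH].
  by rewrite addn0 !big_geq // mul0r addr0.
rewrite addnS [LHS]big_nat_recr ?leq_addr //= IH.
rewrite [X in _ = _ + X]big_nat_recr ?leq_addr //= big_nat_recr ?leq_addr //=.
ring.
Qed.

Lemma abel_bound f w B (a b : nat) :
  (forall n, (a <= n)%N -> w n.+1 <= w n) -> (forall n, 0 <= w n) ->
  (forall c, `|\sum_(a <= n < c) f n| <= B) ->
  `|\sum_(a <= n < b) f n * w n| <= B * w a.
Proof.
move=> dw w0 HB; have B0 : 0 <= B by apply: le_trans (HB 0%N).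
have [ba|ab] := leqP b a; first by rewrite big_geq // normr0 mulr_ge0.
rewrite abel_summation 1?ltnW //; apply: le_trans (ler_normD _ _) _.
apply: le_trans (_ : B * w b + B * (w a - w b) <= _); last by lra.
apply: lerD; first by rewrite normrM (ger0_norm (w0 _)) ler_wpM2r.
apply: le_trans (ler_norm_sum _ _ _) _.
have -> : w a - w b = \sum_(a <= n < b) (w n - w n.+1).
  rewrite -[LHS]opprB -telescope_sumr 1?ltnW // -sumrN.
  by apply: eq_bigr => n _; rewrite opprB.
rewrite mulr_sumr [leLHS]big_nat_cond [leRHS]big_nat_cond; apply: ler_sum => n.
rewrite andbT => /andP[an _]; have := dw n an => d.
by rewrite normrM [X in _ * X <= _]ger0_norm ?subr_ge0 // ler_wpM2r ?subr_ge0.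
Qed.

Lemma lnS_sub n : (0 < n)%N -> ln n.+1%:R - ln n%:R <= n%:R^-1 :> R.
Proof.
move=> n0; have n0' : 0 < n%:R :> R by rewrite ltr0n.
rewrite -ln_div ?posrE ?ltr0n //.
have -> : n.+1%:R / n%:R = 1 + n%:R^-1 :> R by rewrite -natr1; field; rewrite gt_eqF.
by apply: le_ln1Dx; apply: lt_le_trans (ltrN10 _) _; rewrite invr_ge0 ltW.
Qed.

Lemma ln_nat_ge0 n : 0 <= ln n%:R :> R.
Proof.
case: n => [|n]; first by rewrite ln0.
by apply: ln_ge0; rewrite ler1n.
Qed.

Lemma ler_ln_nat (m n : nat) : (0 < m)%N -> (m <= n)%N -> ln m%:R <= ln n%:R :> R.
Proof.
move=> m0 mn; rewrite ler_ln ?posrE ?ltr0n ?ler_nat //.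
exact: leq_trans mn.
Qed.

Lemma ln_fact_ge x : x%:R * ln x%:R - x%:R <= \sum_(1 <= n < x.+1) ln n%:R :> R.
Proof.
elim: x => [|x IH]; first by rewrite mul0r subr0 big_geq.
rewrite big_nat_recr //=; case: x IH => [|x] IH.
  by rewrite big_geq // ln1; lra.
apply: le_trans _ (lerD IH (lexx _)).
have := lnS_sub (ltn0Sn x).
have x0 : 0 < x.+1%:R :> R by rewrite ltr0n.
rewrite -(ler_pM2l x0) divff ?gt_eqF // -[x.+2%:R]natr1; nra.
Qed.

Lemma ln_fact_le x : \sum_(1 <= n < x.+1) ln n%:R <= x%:R * ln x%:R :> R.
Proof.
have -> : x%:R * ln x%:R = \sum_(1 <= n < x.+1) ln x%:R :> R.
  by rewrite sumr_const_nat subn1 mulr_natl.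
rewrite [leLHS]big_nat_cond [leRHS]big_nat_cond; apply: ler_sum => n.
by rewrite andbT => /andP[n0 nx]; apply: ler_ln_nat.
Qed.

Definition mangoldt n : R := if primes n is [:: p] then ln p%:R else 0.

Lemma mangoldt_ge0 n : 0 <= mangoldt n.
Proof. by rewrite /mangoldt; case: primes => [|p [|q s]] //; apply: ln_nat_ge0. Qed.

Lemma mangoldt_pfactor (p a : nat) : prime p -> (0 < a)%N -> mangoldt (p ^ a) = ln p%:R.
Proof. by move=> pp a0; rewrite /mangoldt primesX // primes_prime. Qed.

Lemma mangoldt_prime (p : nat) : prime p -> mangoldt p = ln p%:R.
Proof. by move=> pp; rewrite -[p in LHS]expn1 mangoldt_pfactor. Qed.

Lemma mangoldt_coprime (a b : nat) : (1 < a)%N -> (1 < b)%N -> coprime a b ->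
  mangoldt (a * b) = 0.
Proof.
move=> a1 b1 cab; rewrite /mangoldt; case E: primes => [|p [|]] //.
have H c : (1 < c)%N -> (c %| a * b)%N -> pdiv c = p.
  move=> c1 cd; apply/eqP; rewrite -[_ == _]mem_seq1 -E mem_primes pdiv_prime //.
  by rewrite muln_gt0 (ltnW a1) (ltnW b1) (dvdn_trans (pdiv_dvd c)).
have pa := H a a1 (dvdn_mulr b (dvdnn a)); have pb := H b b1 (dvdn_mull a (dvdnn b)).
have : (pdiv a %| gcdn a b)%N by rewrite dvdn_gcd pdiv_dvd pa -pb pdiv_dvd.
by rewrite (eqP cab) dvdn1 => /eqP p1; have := pdiv_prime a1; rewrite p1.
Qed.

Lemma sum_mangoldt n : (0 < n)%N -> \sum_(d <- divisors n) mangoldt d = ln n%:R.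
Proof.
move: n; apply: prime_power_ind => [|p a n pp a0 n0 cp IH].
  by rewrite big_seq1 ln1.
have p0 := prime_gt0 pp; have pa0 : (0 < p ^ a)%N by rewrite expn_gt0 p0.
rewrite (perm_big _ (divisors_coprime pa0 n0 cp)) big_allpairs_dep /=.
rewrite (perm_big _ (divisors_pfactor a pp)) big_map.
rewrite -[iota 0 a.+1]/(index_iota 0 a.+1) big_nat_recl //= expn0.
under eq_bigr => d _ do rewrite mul1n.
rewrite IH natrM lnM ?posrE ?ltr0n // natrX lnXn ?ltr0n // addrC; congr (_ + _).
have -> : ln p%:R *+ a = \sum_(0 <= i < a) ln p%:R :> R by rewrite sumr_const_nat subn0.
apply: eq_big_nat => i /andP[_ ia].
rewrite (bigD1_seq 1%N) ?divisors_uniq ?divisor1 //= muln1 mangoldt_pfactor //.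
rewrite big_seq_cond big1 ?addr0 // => d /andP[]; rewrite -dvdn_divisors // => dn d1.
apply: mangoldt_coprime.
- by rewrite -[1%N](exp1n i.+1) ltn_exp2r // prime_gt1.
- by rewrite ltn_neqAle eq_sym d1 (dvdn_gt0 n0 dn).
- apply: coprime_dvdr dn _; apply: coprime_dvdl cp.
  by rewrite dvdn_exp2l.
Qed.

(** Legendre's formula for ln x!: each d contributes [mangoldt d] once for every multiple of d up to
    x. *)
Lemma ln_fact_mangoldt x :
  \sum_(1 <= n < x.+1) ln n%:R = \sum_(1 <= d < x.+1) mangoldt d * (x %/ d)%:R.
Proof.
transitivity (\sum_(1 <= n < x.+1) \sum_(d <- divisors n) mangoldt d).
  by apply: eq_big_nat => n /andP[n0 _]; rewrite sum_mangoldt.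
rewrite (sum_divisors_exchange x (fun d _ => mangoldt d)).
by apply: eq_bigr => d _; rewrite sumr_const_nat subn1 mulr_natr.
Qed.

Definition psi x : R := \sum_(1 <= d < x.+1) mangoldt d.

(** In ln (2n)! - 2 ln n!, the logarithm of the central binomial coefficient, [mangoldt d] has a
    nonnegative coefficient, at least 1 for n < d <= 2n. The crude Stirling bounds give at most 2n
    ln 2 + 2n. *)
Lemma psi_double n : psi n.*2 - psi n <= 4 * n%:R.
Proof.
case: n => [|n]; first by rewrite /psi !big_geq // subrr mulr0.
set N := n.+1; have N0 : (0 < N)%N by [].
apply: (@le_trans _ _ (\sum_(1 <= m < N.*2.+1) ln m%:R - 2 * \sum_(1 <= m < N.+1) ln m%:R)).
  have NN : (N.+1 <= N.*2.+1)%N by rewrite ltnS -addnn leq_addr.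
  rewrite !ln_fact_mangoldt /psi !(@big_cat_nat _ _ _ N.+1 1 N.*2.+1) //=.
  rewrite addrAC subrr add0r mulr_sumr addrAC -sumrB.
  rewrite -[leLHS]add0r; apply: lerD.
    rewrite big_nat_cond; apply: sumr_ge0 => d; rewrite andbT => /andP[d0 _].
    have -> : mangoldt d * (N.*2 %/ d)%:R - 2 * (mangoldt d * (N %/ d)%:R)
        = mangoldt d * ((N.*2 %/ d)%:R - (N %/ d).*2%:R).
      by rewrite -[(N %/ d).*2]addnn natrD; ring.
    rewrite mulr_ge0 ?mangoldt_ge0 // subr_ge0 ler_nat leq_divRL //.
    by rewrite -doubleMl leq_double leq_trunc_div.
  rewrite [leLHS]big_nat_cond [leRHS]big_nat_cond; apply: ler_sum => d.
  rewrite andbT => /andP[dN d2]; rewrite -{1}[mangoldt d]mulr1 ler_wpM2l ?mangoldt_ge0 //.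
  by rewrite ler1n divn_gt0 // (leq_trans _ dN).
have h1 := ln_fact_le N.*2; have h2 := ln_fact_ge N.
apply: le_trans (lerD h1 (lexx _)) _.
have -> : ln N.*2%:R = ln 2 + ln N%:R :> R.
  by rewrite -muln2 mulnC natrM lnM // posrE ltr0n.
have ln2 : ln 2 <= 1 :> R by have := lnS_sub (ltn0Sn 0); rewrite ln1 invr1 subr0.
have NR : 0 <= N%:R :> R by rewrite ler0n.
rewrite -addnn natrD; nra.
Qed.

(** With h = ceil(x/2), psi x <= psi h + 4 h <= 16 h <= 8 (x + 1), and this is at most 12 x once x
    >= 2; hence the constant. *)
Lemma psi_le x : psi x <= 12 * x%:R.
Proof.
have mono y z : (y <= z)%N -> psi y <= psi z.
  move=> yz; rewrite /psi (@big_cat_nat _ _ _ y.+1 1 z.+1) //= lerDl.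
  by apply: sumr_ge0 => d _; apply: mangoldt_ge0.
have [m] := ubnP x; elim: m x => // m IH x xm.
have [x1|x1] := leqP x 1.
  case: x x1 {xm} => [|[|]] // _; first by rewrite /psi big_geq // mulr0.
  by rewrite /psi big_nat1 /mangoldt /= mulr1.
pose h := uphalf x; have hx : (x <= h.*2)%N by rewrite /h; lia.
have h2 : (h.*2 <= x.+1)%N by rewrite /h; lia.
have hm : (h < m)%N by lia.
have := IH h hm; have := psi_double h; have := mono _ _ hx.
move: h2; rewrite -(ler_nat R) -addnn natrD -[x.+1%:R]natr1.
have : 2 <= x%:R :> R by rewrite (ler_nat R 2).
lra.
Qed.

Lemma mertens_ge x : (0 < x)%N -> ln x%:R - 1 <= \sum_(1 <= d < x.+1) mangoldt d / d%:R.
Proof.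
move=> x0; have x0' : 0 < x%:R :> R by rewrite ltr0n.
rewrite -(ler_pM2l x0'); have := ln_fact_ge x; rewrite ln_fact_mangoldt => h.
rewrite mulrBr mulr1; apply: le_trans h _; rewrite mulr_sumr.
rewrite [leLHS]big_nat_cond [leRHS]big_nat_cond; apply: ler_sum => d.
rewrite andbT => /andP[d0 _]; rewrite mulrCA ler_wpM2l ?mangoldt_ge0 //.
by rewrite ler_pdivlMr ?ltr0n // -natrM ler_nat leq_trunc_div.
Qed.

Lemma mertens_le x : (0 < x)%N -> \sum_(1 <= d < x.+1) mangoldt d / d%:R <= ln x%:R + 12.
Proof.
move=> x0; have x0' : 0 < x%:R :> R by rewrite ltr0n.
rewrite -(ler_pM2l x0'); have := ln_fact_le x; rewrite ln_fact_mangoldt => h.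
rewrite mulrDr [x%:R * 12]mulrC; apply: le_trans _ (lerD h (psi_le x)).
rewrite /psi -big_split /= mulr_sumr.
rewrite [leLHS]big_nat_cond [leRHS]big_nat_cond; apply: ler_sum => d.
rewrite andbT => /andP[d0 _].
rewrite mulrCA -{3}[mangoldt d]mulr1 -mulrDr ler_wpM2l ?mangoldt_ge0 //.
rewrite ler_pdivrMr ?ltr0n // natr1 -natrM ler_nat.
by rewrite {1}(divn_eq x d) mulSn addnC leq_add2r ltnW // ltn_pmod.
Qed.

Lemma sum_ln_sq x : \sum_(2 <= n < x) ln n%:R / (n%:R * (n%:R - 1)) <= 2 :> R.
Proof.
(* The summand at n.+1 is at most a n - a n.+1, so the sum telescopes. *)
pose a n : R := (ln n%:R + 2) / n%:R.
have a0 n : 0 <= a n by rewrite divr_ge0 ?ler0n // addr_ge0 // ln_nat_ge0.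
have [x2|x2] := leqP x 2; first by rewrite big_geq.
have -> : 2 = a 1%N by rewrite /a ln1; lra.
apply: (@le_trans _ _ (a 1%N - a x.-1)); last by rewrite gerBl.
have -> : a 1%N - a x.-1 = \sum_(1 <= n < x.-1) (a n - a n.+1).
  rewrite -[LHS]opprB -telescope_sumr; last by case: x x2 => [|[|]].
  by rewrite -sumrN; apply: eq_bigr => n _; rewrite opprB.
rewrite big_add1 /= [leLHS]big_nat_cond [leRHS]big_nat_cond; apply: ler_sum => n.
rewrite andbT => /andP[n0 _].
have h := lnS_sub n0; have n1 : 1 <= n%:R :> R by rewrite ler1n.
have l0 := ln_nat_ge0 n.+1.
rewrite /a; set L := ln n.+1%:R in h l0 *; set l := ln n%:R in h *.
rewrite -natr1 addrK; set y := n%:R in h n1 *.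
have y0 : 0 < y by lra.
apply: (@le_trans _ _ ((L - y^-1 + 2) / y - (L + 2) / (y + 1))); last first.
  by rewrite lerD2r ler_wpM2r ?invr_ge0 ?(ltW y0) //; lra.
rewrite -subr_ge0.
have -> : (L - y^-1 + 2) / y - (L + 2) / (y + 1) - L / ((y + 1) * y)
   = (y - 1) / (y ^+ 2 * (y + 1)).
  by field; rewrite !gt_eqF //; lra.
rewrite divr_ge0 ?mulr_ge0 ?exprn_ge0 //; lra.
Qed.

(** Only powers p^j with j >= 2 contribute. For fixed p the sum of p^(-j) is at most 1 / (p (p-1)),
    and letting p run over all integers from 2 on leaves the sum bounded in [sum_ln_sq]. *)
Lemma mertens_nonprime x :
  \sum_(1 <= d < x.+1 | ~~ prime d) mangoldt d / d%:R <= 2.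
Proof.
apply: le_trans _ (sum_ln_sq x.+1).
apply: (@le_trans _ _ (\sum_(1 <= d < x.+1) \sum_(2 <= p < x.+1) \sum_(2 <= j < x.+1)
   (if (p ^ j)%N == d then ln p%:R / p%:R ^+ j else 0))).
  rewrite big_mkcond [leLHS]big_nat_cond [leRHS]big_nat_cond; apply: ler_sum => d.
  rewrite andbT => /andP[d0 dx].
  have nn p j : 0 <= (if (p ^ j)%N == d then ln p%:R / p%:R ^+ j else 0) :> R.
    by case: eqP => // _; rewrite divr_ge0 ?ln_nat_ge0 ?exprn_ge0 ?ler0n.
  have nn' p : 0 <= \sum_(2 <= j < x.+1) (if (p ^ j)%N == d then ln p%:R / p%:R ^+ j else 0) :> R.
    by apply: sumr_ge0.
  case: ifP => pd; last exact: sumr_ge0.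
  rewrite /mangoldt; case E: (primes d) => [|p [|q s]]; rewrite ?mul0r; try exact: sumr_ge0.
  have : p \in primes d by rewrite E inE.
  rewrite mem_primes => /and3P[pp _ pdv].
  have dE : d = (p ^ logn p d)%N.
    by rewrite {1}(prod_prime_decomp d0) prime_decompE E /= big_seq1.
  have p1 := prime_gt1 pp.
  have j2 : (1 < logn p d)%N.
    rewrite ltnNge; apply: contraL pd => j1; rewrite negbK dE.
    have : (0 < logn p d)%N by rewrite logn_gt0 E inE.
    by case: (logn p d) j1 => [|[|]] // _ _; rewrite expn1.
  have jx : (logn p d < x.+1)%N by apply: leq_ltn_trans dx; rewrite ltnW // ltn_logl.
  have px : (p < x.+1)%N by apply: leq_ltn_trans dx; apply: dvdn_leq.
  rewrite (bigD1_seq p) ?iota_uniq ?mem_index_iota ?p1 //=.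
  rewrite -[leLHS]addr0; apply: lerD; last by apply: sumr_ge0.
  rewrite (bigD1_seq (logn p d)) ?iota_uniq ?mem_index_iota ?j2 //=.
  rewrite -[leLHS]addr0; apply: lerD; last by apply: sumr_ge0.
  by rewrite -dE eqxx {1}dE natrX.
rewrite exchange_big /= [leLHS]big_nat_cond [leRHS]big_nat_cond; apply: ler_sum => p.
rewrite andbT => /andP[p2 _]; rewrite exchange_big /=.
have p2' : 2 <= p%:R :> R by rewrite (ler_nat R 2).
set u : R := p%:R^-1.
have u0 : 0 < u by rewrite invr_gt0; lra.
have u1 : u < 1 by rewrite invf_lt1; lra.
apply: (@le_trans _ _ (\sum_(2 <= j < x.+1) ln p%:R * u ^+ j)).
  apply: ler_sum => j _.
  have t0 : 0 <= ln p%:R * u ^+ j by rewrite mulr_ge0 ?ln_nat_ge0 ?exprn_ge0 // ltW.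
  rewrite -big_mkcond /= big_const_seq iter_addr_0 -exprVn -/u.
  have : (count (pred1 (p ^ j)%N) (index_iota 1 x.+1) <= 1)%N.
    by rewrite count_uniq_mem ?iota_uniq // leq_b1.
  rewrite (eq_count (a2 := pred1 (p ^ j)%N)); last by move=> d /=; rewrite eq_sym.
  by case: (count _ _) => [|[|]] //; rewrite mulr0n.
rewrite -mulr_sumr ler_wpM2l ?ln_nat_ge0 //.
have -> : (p%:R * (p%:R - 1))^-1 = u ^+ 2 / (1 - u).
  by rewrite /u; field; rewrite !gt_eqF //; lra.
rewrite ler_pdivlMr ?subr_gt0 //.
case: x => [|x]; first by rewrite big_geq // mul0r exprn_ge0 // ltW.
rewrite -[2%N]addn0 -[x.+2]addn2 addnC big_addn addnK.
under eq_bigr => j _ do rewrite exprD.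
rewrite -mulr_suml mulrAC -[leRHS]mul1r ler_wpM2r ?exprn_ge0 ?(ltW u0) //.
rewrite big_mkord mulrC -opprB mulNr -subrX1 opprB.
by rewrite gerBl exprn_ge0 // ltW.
Qed.

End RealSums.

(** * Non-vanishing for real characters *)

Lemma ln_unbounded (R : realType) (K : R) : exists2 n : nat, (0 < n)%N & K < ln n%:R.
Proof.
have := archi_boundP (expR_ge0 K); set n := Num.Def.archi_bound _ => h.
have n0 : 0 < n%:R :> R by apply: le_lt_trans (expR_ge0 K) h.
exists n; first by rewrite -(ltr0n R).
by rewrite -[K]expRK ltr_ln ?posrE ?expR_gt0.
Qed.

Section RealCharacter.
Variables (R : realType) (X : nat -> R) (B C : R).
Hypothesis X1 : X 1 = 1.
Hypothesis XM : forall a b, X (a * b)%N = X a * X b.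
Hypothesis X_values : forall n, [\/ X n = 0, X n = 1 | X n = -1].
Hypothesis X_sum : forall a b, `|\sum_(a <= n < b) X n| <= B.
Hypothesis X_L1 : forall n, `|\sum_(1 <= d < n.+1) X d / d%:R| <= C / n.+1%:R.

(** The convolution of 1 and X, that is, the coefficients of zeta(s) L(s, X). *)
Let char_divisors (n : nat) : R := \sum_(d <- divisors n) X d.

Lemma geometric_ge (x : R) (a : nat) : [\/ x = 0, x = 1 | x = -1] ->
  0 <= \sum_(i < a.+1) x ^+ i /\ 1 <= \sum_(i < (a * 2).+1) x ^+ i.
Proof.
case=> ->.
- by split; rewrite big_ord_recl expr0 big1 ?addr0 // => i _; rewrite expr0n.
- have E n : \sum_(i < n) 1 ^+ i = n%:R :> R.
    by rewrite (eq_bigr (fun=> 1)) => [|i _]; rewrite ?expr1n // sumr_const card_ord.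
  by rewrite !E ler0n ler1n.
have E n : \sum_(i < n) (-1) ^+ i = (odd n)%:R :> R.
  elim: n => [|n IH]; first by rewrite big_ord0.
  by rewrite big_ord_recr /= IH -signr_odd; case: (odd n) => /=; lra.
by rewrite !E ler0n /= oddM andbF.
Qed.

Lemma charX n a : X (n ^ a)%N = X n ^+ a.
Proof. by elim: a => [|a IH]; rewrite ?expn0 ?expr0 // expnS exprS XM IH. Qed.

Lemma char_divisors_ge0 n : (0 < n)%N -> 0 <= char_divisors n.
Proof.
move: n; apply: prime_power_ind => [|p a n pp a0 n0 cp IH].
  by rewrite /char_divisors big_seq1 X1.
rewrite /char_divisors (@sum_divisors_pfactor R X) //; apply: mulr_ge0 => //.
under eq_bigr => i _ do rewrite charX.
by have [] := geometric_ge a (X_values p).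
Qed.

Lemma char_divisors_sqr n : (0 < n)%N -> 1 <= char_divisors (n ^ 2).
Proof.
move: n; apply: prime_power_ind => [|p a n pp a0 n0 cp IH].
  by rewrite exp1n /char_divisors big_seq1 X1.
rewrite expnMn -expnM /char_divisors (@sum_divisors_pfactor R X) ?muln_gt0 ?a0 ?expn_gt0 ?n0 //.
  rewrite -[leLHS]mul1r; apply: ler_pM => //.
  under eq_bigr => i _ do rewrite charX.
  by have [] := geometric_ge a (X_values p).
by rewrite expnM coprimeXl // coprimeXr.
Qed.

Let sqrtn (n : nat) : R := Num.sqrt n%:R.

Lemma sqrtn_gt0 n : (0 < n)%N -> 0 < sqrtn n.
Proof. by move=> n0; rewrite sqrtr_gt0 ltr0n. Qed.

Lemma sqrtn_ge0 n : 0 <= sqrtn n.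
Proof. exact: sqrtr_ge0. Qed.

Lemma sqrtn_sqr n : sqrtn n ^+ 2 = n%:R.
Proof. by rewrite sqr_sqrtr ?ler0n. Qed.

Lemma sqrtn_X2 n : sqrtn (n ^ 2) = n%:R.
Proof. by rewrite /sqrtn natrX sqrtr_sqr ger0_norm ?ler0n. Qed.

Lemma sqrtnM a b : sqrtn (a * b) = sqrtn a * sqrtn b.
Proof. by rewrite /sqrtn natrM sqrtrM ?ler0n. Qed.

Lemma harmonic_ge N : ln N.+1%:R <= \sum_(1 <= j < N.+1) j%:R^-1 :> R.
Proof.
elim: N => [|N IH]; first by rewrite ln1 big_geq.
rewrite big_nat_recr //=; have := lnS_sub R (ltn0Sn N).
set u := N.+1%:R^-1; lra.
Qed.

(** The coefficients are nonnegative and at least 1 at squares; with the weight 1 / sqrt n, the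
    square j^2 alone contributes 1/j. *)
Lemma char_sum_lower N :
  \sum_(1 <= j < N.+1) j%:R^-1 <= \sum_(1 <= n < (N ^ 2).+1) char_divisors n / sqrtn n.
Proof.
elim: N => [|N IH]; first by rewrite !big_geq.
have NN : (N ^ 2 < N.+1 ^ 2)%N by rewrite ltn_exp2r.
rewrite big_nat_recr //= (@big_cat_nat _ _ _ (N ^ 2).+1 1 (N.+1 ^ 2).+1) ?ltnS ?(ltnW NN) //=.
apply: lerD => //.
rewrite big_nat_recr //= -[leLHS]add0r; apply: lerD.
  rewrite big_nat_cond; apply: sumr_ge0 => n; rewrite andbT => /andP[n0 _].
  by rewrite divr_ge0 ?sqrtn_ge0 // char_divisors_ge0 // (leq_trans _ n0).
by rewrite sqrtn_X2 -[leLHS]mul1r ler_wpM2r ?invr_ge0 ?ler0n // char_divisors_sqr.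
Qed.

Let inv_sqrt_sum (z : nat) : R := \sum_(1 <= e < z.+1) (sqrtn e)^-1.
Let sqrt_defect (z : nat) : R := 2 * sqrtn z - inv_sqrt_sum z.

Lemma sqrtn_step z : (0 < z)%N ->
  [/\ sqrtn z <= sqrtn z.+1, (sqrtn z.+1)^-1 <= 2 * (sqrtn z.+1 - sqrtn z)
    & 2 * (sqrtn z.+1 - sqrtn z) <= (sqrtn z)^-1].
Proof.
move=> z0; have a0 := sqrtn_gt0 z0; have b0 := sqrtn_gt0 (ltn0Sn z).
have ab : sqrtn z.+1 ^+ 2 = sqrtn z ^+ 2 + 1 by rewrite !sqrtn_sqr natr1.
set a := sqrtn z in a0 ab *; set b := sqrtn z.+1 in b0 ab *.
have le : a <= b by rewrite -(ler_pXn2r (n := 2)) ?nnegrE ?(ltW a0) ?(ltW b0) // ab; lra.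
have E : (b - a) * (b + a) = 1 by rewrite -subr_sqr ab; ring.
split=> //.
  by rewrite -[leLHS]mul1r ler_pdivrMr // -[leLHS]E; nra.
by rewrite -[leRHS]mul1r ler_pdivlMr // -[leRHS]E; nra.
Qed.

(* The partial sums of 1/sqrt e are 2 sqrt z + c + O(1/sqrt z), which makes the main term of the
   hyperbola method below equal to 2 N L(1, X), with an error O(1). *)
Lemma sqrt_defect_step z d : (0 < z)%N ->
  0 <= sqrt_defect (z + d) - sqrt_defect z <= (sqrtn z)^-1 - (sqrtn (z + d))^-1.
Proof.
move=> z0; elim: d => [|d /andP[IH1 IH2]]; first by rewrite addn0 !subrr lexx.
have [h1 h2 h3] := sqrtn_step (ltn_addr d z0); rewrite addnS.
have E : sqrt_defect (z + d).+1 =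
    sqrt_defect (z + d) + 2 * (sqrtn (z + d).+1 - sqrtn (z + d)) - (sqrtn (z + d).+1)^-1.
  rewrite /sqrt_defect /inv_sqrt_sum [X in _ - X = _]big_nat_recr //=; ring.
by rewrite E; apply/andP; split; lra.
Qed.

Lemma sqrt_defect1 : sqrt_defect 1 = 1.
Proof. by rewrite /sqrt_defect /inv_sqrt_sum big_nat1 /sqrtn sqrtr1 invr1; lra. Qed.

Lemma sqrt_defect_bound z : (0 < z)%N -> 1 <= sqrt_defect z <= 2.
Proof.
case: z => // z _; have := sqrt_defect_step z (isT : 0 < 1)%N.
rewrite sqrt_defect1 add1n /sqrtn sqrtr1 invr1 -/(sqrtn _).
have := sqrtn_gt0 (ltn0Sn z); rewrite -invr_gt0 => h /andP[h1 h2].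
by apply/andP; split; lra.
Qed.

Lemma inv_sqrt_sum_le z : (0 < z)%N -> inv_sqrt_sum z <= 2 * sqrtn z.
Proof. by move=> z0; have := sqrt_defect_bound z0; rewrite /sqrt_defect => /andP[]; lra. Qed.

(** Let z = floor(N^2/d) and t = N / sqrt d, so that sqrt z <= t <= sqrt (z+1). Replacing 2 sqrt z
    by 2 t and the defect at z by the one at N^2 makes errors of opposite signs, each at most 1 /
    sqrt z <= 2 / t. The defect at N^2 is independent of d and will factor out of sums over d. *)
Lemma inv_sqrt_sum_approx N d : (0 < d)%N -> (d <= N)%N ->
  `|inv_sqrt_sum (N ^ 2 %/ d) - 2 * N%:R / sqrtn d + sqrt_defect (N ^ 2)| <= 2 * sqrtn d / N%:R.
Proof.
move=> d0 dN; have N0 := leq_trans d0 dN; have NR : 0 < N%:R :> R by rewrite ltr0n.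
have sd := sqrtn_gt0 d0.
set z := (N ^ 2 %/ d)%N; pose t := N%:R / sqrtn d.
have t0 : 0 < t by rewrite divr_gt0.
have t2 : t ^+ 2 = (N ^ 2)%:R / d%:R by rewrite expr_div_n sqrtn_sqr natrX.
have z0 : (0 < z)%N by rewrite divn_gt0 // (leq_trans dN) // -[X in (X <= _)%N]expn1 leq_pexp2l.
have zt : z%:R <= t ^+ 2 by rewrite t2 ler_pdivlMr ?ltr0n // -natrM ler_nat leq_trunc_div.
have tz : t ^+ 2 <= z.+1%:R.
  by rewrite t2 ler_pdivrMr ?ltr0n // -natrM ler_nat ltnW // ltn_ceil.
have zN : (z <= N ^ 2)%N by apply: leq_div.
have := sqrt_defect_step (N ^ 2 - z) z0; rewrite subnKC // => /andP[Q1 Q2].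
have [h1 h2 h3] := sqrtn_step z0.
have a0 := sqrtn_gt0 z0; have b0 := sqrtn_gt0 (ltn0Sn z).
have at_ : sqrtn z <= t by rewrite -(ler_pXn2r (n := 2)) ?nnegrE ?(ltW a0) ?(ltW t0) // sqrtn_sqr.
have tb : t <= sqrtn z.+1 by rewrite -(ler_pXn2r (n := 2)) ?nnegrE ?(ltW b0) ?(ltW t0) // sqrtn_sqr.
have ta : t <= 2 * sqrtn z.
  have a2 : 0 <= 2 * sqrtn z by apply: mulr_ge0 => //; apply: ltW.
  rewrite -(ler_pXn2r (n := 2)) ?nnegrE ?a2 ?(ltW t0) // [leRHS]exprMn sqrtn_sqr.
  apply: le_trans tz _; have : 1 <= z%:R :> R by rewrite ler1n.
  by rewrite -natr1; lra.
have -> : 2 * sqrtn d / N%:R = 2 / t by rewrite /t; field; rewrite !gt_eqF.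
have : (sqrtn z)^-1 <= 2 / t.
  by rewrite -[leLHS]mul1r ler_pdivrMr // mulrAC ler_pdivlMr // mul1r.
rewrite (_ : 2 * N%:R / sqrtn d = 2 * t); last by rewrite /t mulrA.
have E : inv_sqrt_sum z = 2 * sqrtn z - sqrt_defect z by rewrite /sqrt_defect; ring.
have c0 : 0 < (sqrtn (N ^ 2))^-1 by rewrite invr_gt0; apply: sqrtn_gt0; rewrite expn_gt0 N0.
rewrite E ler_norml; set a := (sqrtn z)^-1 in h3 Q2 * => h4.
by apply/andP; split; lra.
Qed.

Lemma inv_sqrtn_decr n : (0 < n)%N -> (sqrtn n.+1)^-1 <= (sqrtn n)^-1.
Proof.
by move=> n0; rewrite lef_pV2 ?posrE ?sqrtn_gt0 //; have [] := sqrtn_step n0.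
Qed.

Lemma inv_sqrtn_ge0 n : 0 <= (sqrtn n)^-1.
Proof. by rewrite invr_ge0 sqrtn_ge0. Qed.

Lemma norm_X_le1 n : `|X n| <= 1.
Proof. by case: (X_values n) => ->; rewrite ?normr0 ?normrN ?normr1. Qed.

(** Hyperbola method cut at d = N. For d <= N the main term 2 N sum X(d)/d costs 2 C, the common
    defect times sum X(d) / sqrt d costs 2 B, and the N errors of size 2 / N cost 2. For d > N the
    sum over d is done inside: it is at most B / sqrt N, and summing 1 / sqrt e over e <= N gives 2
    B more. *)
Lemma char_sum_upper N : (0 < N)%N ->
  \sum_(1 <= n < (N ^ 2).+1) char_divisors n / sqrtn n <= 2 * C + 4 * B + 2.
Proof.
move=> N0; have NR : 0 < N%:R :> R by rewrite ltr0n.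
have B0 : 0 <= B by apply: le_trans (X_sum 0 0).
have C0 : 0 <= C by have := X_L1 0; rewrite divr1; apply: le_trans.
have -> : \sum_(1 <= n < (N ^ 2).+1) char_divisors n / sqrtn n
    = \sum_(1 <= d < (N ^ 2).+1) X d / sqrtn d * inv_sqrt_sum (N ^ 2 %/ d).
  transitivity (\sum_(1 <= n < (N ^ 2).+1) \sum_(d <- divisors n) X d / sqrtn d * (sqrtn (n %/ d))^-1).
    apply: eq_big_nat => n /andP[n0 _]; rewrite /char_divisors mulr_suml !big_seq; apply: eq_bigr => d.
    by rewrite -dvdn_divisors // => dn; rewrite -mulrA -invfM -sqrtnM [(d * _)%N]mulnC divnK.
  rewrite (sum_divisors_exchange (N ^ 2) (fun d e => X d / sqrtn d * (sqrtn e)^-1)).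
  by apply: eq_bigr => d _; rewrite -mulr_sumr.
have NN : (N <= N ^ 2)%N by rewrite -[X in (X <= _)%N]expn1 leq_pexp2l.
rewrite (@big_cat_nat _ _ _ N.+1) //=.
have Bsq a b : (0 < a)%N -> `|\sum_(a <= d < b) X d * (sqrtn d)^-1| <= B * (sqrtn a)^-1.
  move=> a0; apply: abel_bound => //.
  - by move=> n an; apply: inv_sqrtn_decr; apply: leq_trans an.
  - exact: inv_sqrtn_ge0.
have -> : \sum_(1 <= d < N.+1) X d / sqrtn d * inv_sqrt_sum (N ^ 2 %/ d) =
    2 * N%:R * (\sum_(1 <= d < N.+1) X d / d%:R)
    - sqrt_defect (N ^ 2) * (\sum_(1 <= d < N.+1) X d * (sqrtn d)^-1)
    + \sum_(1 <= d < N.+1) X d / sqrtn d *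
        (inv_sqrt_sum (N ^ 2 %/ d) - 2 * N%:R / sqrtn d + sqrt_defect (N ^ 2)).
  rewrite !mulr_sumr -sumrB -big_split /=; apply: eq_big_nat => d /andP[d0 _].
  by rewrite -[d%:R in X in X - _]sqrtn_sqr; field; rewrite gt_eqF ?sqrtn_gt0.
have h1 : 2 * N%:R * (\sum_(1 <= d < N.+1) X d / d%:R) <= 2 * C.
  have h := X_L1 N; rewrite ler_norml in h; case/andP: h => _ h.
  rewrite -mulrA ler_pM2l //; apply: le_trans (_ : N%:R * (C / N.+1%:R) <= _).
    by rewrite ler_pM2l.
  by rewrite mulrA ler_pdivrMr ?ltr0n // mulrC ler_wpM2l // ler_nat.
have h2 : - (sqrt_defect (N ^ 2) * (\sum_(1 <= d < N.+1) X d * (sqrtn d)^-1)) <= 2 * B.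
  have := Bsq 1%N N.+1 isT; rewrite /sqrtn sqrtr1 invr1 mulr1 -/sqrtn ler_norml => /andP[b1 b2].
  have /andP[q1' q2] : 1 <= sqrt_defect (N ^ 2) <= 2 by rewrite sqrt_defect_bound // expn_gt0 N0.
  nra.
have h3 : \sum_(1 <= d < N.+1) X d / sqrtn d *
    (inv_sqrt_sum (N ^ 2 %/ d) - 2 * N%:R / sqrtn d + sqrt_defect (N ^ 2)) <= 2.
  apply: (@le_trans _ _ (\sum_(1 <= d < N.+1) 2 / N%:R)); last first.
    by rewrite sumr_const_nat subn1 /= -[_ *+ N]mulr_natr divfK ?gt_eqF.
  rewrite [leLHS]big_nat_cond [leRHS]big_nat_cond; apply: ler_sum => d.
  rewrite andbT ltnS => /andP[d0 dN]; apply: le_trans (ler_norm _) _.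
  have sd := sqrtn_gt0 d0.
  rewrite !normrM (ger0_norm (inv_sqrtn_ge0 _)).
  apply: (@le_trans _ _ (1 * (sqrtn d)^-1 * (2 * sqrtn d / N%:R))); last first.
    rewrite le_eqVlt; apply/orP; left; apply/eqP; field.
    by rewrite !gt_eqF.
  apply: ler_pM; rewrite ?normr_ge0 ?mulr_ge0 ?inv_sqrtn_ge0 //; last exact: inv_sqrt_sum_approx.
  by rewrite ler_wpM2r ?inv_sqrtn_ge0 ?norm_X_le1.
have h4 : \sum_(N.+1 <= d < (N ^ 2).+1) X d / sqrtn d * inv_sqrt_sum (N ^ 2 %/ d) <= 2 * B.
  have -> : \sum_(N.+1 <= d < (N ^ 2).+1) X d / sqrtn d * inv_sqrt_sum (N ^ 2 %/ d)
      = \sum_(1 <= e < (N ^ 2).+1) (sqrtn e)^-1 * \sum_(N.+1 <= d < (N ^ 2 %/ e).+1) X d * (sqrtn d)^-1.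
    transitivity (\sum_(N.+1 <= d < (N ^ 2).+1) \sum_(1 <= e < (N ^ 2).+1 | (e * d <= N ^ 2)%N)
        X d * (sqrtn d)^-1 * (sqrtn e)^-1).
      apply: eq_big_nat => d /andP[d0 _]; have {}d0 : (0 < d)%N by apply: leq_trans d0.
      rewrite /inv_sqrt_sum mulr_sumr (big_nat_widen _ _ (N ^ 2).+1) ?ltnS ?leq_div //.
      by apply: eq_bigl => e; rewrite andTb ltnS leq_divRL.
    rewrite (exchange_big_dep xpredT) //=; apply: eq_big_nat => e /andP[e0 _].
    rewrite mulr_sumr [RHS](big_nat_widen _ _ (N ^ 2).+1) ?ltnS ?leq_div //=.
    apply: eq_big => [d|d _]; first by rewrite ltnS leq_divRL // mulnC.
    by rewrite mulrC.
  (* For e > N no d > N satisfies d e <= N^2. *)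
  rewrite (@big_cat_nat _ _ _ N.+1) //= [X in _ + X]big_nat_cond [X in _ + X]big1 ?addr0; last first.
    move=> e; rewrite andbT => /andP[eN _]; rewrite big_geq ?mulr0 // ltnS -ltnS ltn_divLR.
      by rewrite expnS expn1; nia.
    exact: leq_trans eN.
  apply: (@le_trans _ _ (\sum_(1 <= e < N.+1) (sqrtn e)^-1 * (B * (sqrtn N)^-1))).
    apply: ler_sum => e _; rewrite ler_wpM2l ?inv_sqrtn_ge0 //.
    apply: le_trans (ler_norm _) _; apply: le_trans (Bsq _ _ _) _ => //.
    by rewrite ler_wpM2l // inv_sqrtn_decr.
  rewrite -mulr_suml -/(inv_sqrt_sum N); apply: (@le_trans _ _ (2 * sqrtn N * (B * (sqrtn N)^-1))).
    by rewrite ler_wpM2r ?inv_sqrt_sum_le // mulr_ge0 ?inv_sqrtn_ge0.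
  rewrite le_eqVlt; apply/orP; left; apply/eqP; field.
  by rewrite gt_eqF // sqrtn_gt0.
lra.
Qed.

Lemma no_vanishing_real_character : False.
Proof.
have [N N0] := ln_unbounded (2 * C + 4 * B + 2); apply/negP; rewrite -leNgt.
apply: le_trans (char_sum_upper N0); apply: le_trans (char_sum_lower N).
by apply: le_trans (harmonic_ge N); apply: ler_ln_nat.
Qed.

End RealCharacter.

(** * Primes in arithmetic progressions *)

Section CauchyRate.
Import classical_sets.

(** The limit is the supremum of the lower bounds u n - C / (n+1), each of which lies below every
    upper bound u p + C / (p+1). *)
Lemma cauchy_rate_limit (R : realType) (u : nat -> R) (C : R) :
  (forall n p, (n <= p)%N -> `|u p - u n| <= C / n.+1%:R) ->
  exists l, forall n, `|u n - l| <= C / n.+1%:R.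
Proof.
move=> H; pose A := [set x : R | exists n, x = u n - C / n.+1%:R]%classic.
have HH n p : u n - C / n.+1%:R <= u p + C / p.+1%:R.
  have C0 j : 0 <= C / j.+1%:R by apply: le_trans (normr_ge0 _) (H j j (leqnn _)).
  have := C0 n; have := C0 p; set a := C / n.+1%:R; set b := C / p.+1%:R.
  case: (leqP n p) => [np|/ltnW np]; have := H _ _ np; rewrite -/a -/b.
    by rewrite ler_norml => /andP[]; lra.
  by rewrite ler_norml => /andP[]; lra.
have ubA p : (ubound A (u p + C / p.+1%:R))%classic by move=> x [n ->]; apply: HH.
have supA : has_sup A.
  by split; [exists (u 0%N - C / 1%:R), 0%N|exists (u 0%N + C / 1%:R); apply: ubA].
exists (sup A) => n; rewrite ler_norml.
have h1 : sup A <= u n + C / n.+1%:R by apply: ge_sup; [case: supA|apply: ubA].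
have h2 : u n - C / n.+1%:R <= sup A by apply: ub_le_sup; [case: supA|exists n].
set a := C / _ in h1 h2 *; by apply/andP; split; lra.
Qed.

End CauchyRate.

(** * Kernel and image of a normal matrix *)

Section NormalDecomposition.
Variables (R : realFieldType) (n : nat) (A : 'M[R]_n).

Lemma mulmx_tr_eq0 (v : 'rV[R]_n) : v *m v^T = 0 -> v = 0.
Proof.
move=> /matrixP/(_ 0 0); rewrite !mxE => E; apply/rowP => j; rewrite mxE.
have /psumr_eq0P : forall i, true -> 0 <= v 0 i * (v^T) i 0.
  by move=> i _; rewrite mxE -expr2 sqr_ge0.
by move=> /(_ E j isT)/eqP; rewrite mxE mulf_eq0 orbb => /eqP.
Qed.

Hypothesis A_normal : A^T *m A = A *m A^T.

(** M = A^T A is symmetric, so M and M^2 have the same kernel and the same row space; subtracting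
    from d a suitable vector of the row space of M leaves w with w M = 0. Positivity then gives w
    A^T = 0, and normality w A = 0. *)
Lemma normal_decomposition (d : 'rV[R]_n) : exists z w : 'rV[R]_n,
  [/\ d = z *m A^T *m A + w, w *m A = 0 & w *m A^T = 0].
Proof.
pose M := A^T *m A.
have MT : M^T = M by rewrite /M trmx_mul trmxK.
have kerM (w : 'rV[R]_n) : w *m M *m M = 0 -> w *m M = 0.
  by move=> E; apply: mulmx_tr_eq0; rewrite trmx_mul MT mulmxA E mul0mx.
have rk : (M <= M *m M)%MS.
  have h : (M *m M <= M)%MS by apply: submxMl.
  rewrite -(geq_leqif (mxrank_leqif_sup h)).
  have : (\rank (kermx (M *m M)) <= \rank (kermx M))%N.
    apply: mxrankS; apply/row_subP => i; apply/sub_kermxP; apply: kerM.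
    by rewrite -mulmxA -row_mul mulmx_ker row0.
  by rewrite !mxrank_ker leq_sub2lE ?rank_leq_row.
have /submxP[z zE] : (d *m M <= M *m M)%MS by apply: submx_trans rk; apply: submxMl.
exists z, (d - z *m M); have w0 : (d - z *m M) *m M = 0.
  by rewrite mulmxBl zE [z *m (M *m M)]mulmxA subrr.
set w := d - z *m M in w0 *; split.
- by rewrite -mulmxA -/M /w addrC subrK.
- by apply: mulmx_tr_eq0; rewrite trmx_mul mulmxA -(mulmxA w) -A_normal w0 mul0mx.
by apply: mulmx_tr_eq0; rewrite trmx_mul trmxK mulmxA -(mulmxA w) w0 mul0mx.
Qed.

End NormalDecomposition.

Section Dirichlet.
(* G stands for the group of units modulo m and cls for reduction modulo m. *)
Variables (R : realType) (G : finGroupType) (m : nat) (cls : nat -> G).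
Hypothesis mulGC : commutative (@mulg G).
Hypothesis m_gt0 : (0 < m)%N.
Hypothesis clsM : forall a b, coprime m a -> coprime m b -> cls (a * b) = (cls a * cls b)%g.
Hypothesis sum_period : forall (F : G -> R) a,
  \sum_(a <= i < a + m | coprime m i) F (cls i) = \sum_g F g.

Implicit Types (F : G -> R) (g h u : G) (n d e x : nat).

(** Substitute for a Dirichlet character: a translate of [F] pulled back to the integers. Since [F]
    need not be multiplicative, the shift [g] is carried along to absorb factors of n. *)
Definition on_nat F g n : R := if coprime m n then F (g * cls n)%g else 0.

Lemma cls1 : cls 1 = 1%g.
Proof.
have := clsM (coprimen1 m) (coprimen1 m); rewrite muln1 => E.
by apply: (mulgI (cls 1)); rewrite mulg1.
Qed.

Lemma on_nat1 F g : on_nat F g 1 = F g.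
Proof. by rewrite /on_nat coprimen1 cls1 mulg1. Qed.

Lemma on_natM F g d e :
  on_nat F g (d * e) = if coprime m d then on_nat F (g * cls d)%g e else 0.
Proof.
rewrite /on_nat coprimeMr; case cd: (coprime m d) => //=.
by case ce: (coprime m e); rewrite // clsM // mulgA.
Qed.

Lemma sum_shift F g : \sum_u F (g * u)%g = \sum_u F u.
Proof. by rewrite [RHS](reindex_inj (mulgI g)). Qed.

Definition norm1 F : R := \sum_u `|F u|.

Lemma norm1_ge0 F : 0 <= norm1 F.
Proof. by apply: sumr_ge0. Qed.

Lemma norm_le_norm1 F g : `|F g| <= norm1 F.
Proof. by rewrite /norm1 (bigD1 g) //= lerDl sumr_ge0. Qed.

Lemma on_nat_le F g n : `|on_nat F g n| <= norm1 F.
Proof. by rewrite /on_nat; case: ifP; rewrite ?norm_le_norm1 // normr0 norm1_ge0. Qed.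

Lemma on_nat_sum_bound F g a b : \sum_u F u = 0 ->
  `|\sum_(a <= n < b) on_nat F g n| <= norm1 F.
Proof.
move=> F0; have [q] := ubnP (b - a); elim: q a => // q IH a bq.
have [bam|bam] := leqP (a + m) b.
  rewrite (@big_cat_nat _ _ _ (a + m)) ?leq_addr //=.
  rewrite -big_mkcond (sum_period (fun c => F (g * c)%g)) sum_shift F0 add0r.
  by apply: IH; lia.
apply: le_trans (ler_norm_sum _ _ _) _.
have [ab|ab] := leqP a b; last by rewrite big_geq ?norm1_ge0 // ltnW.
apply: (@le_trans _ _ (\sum_(a <= n < a + m) `|on_nat F g n|)).
  by rewrite [leRHS](@big_cat_nat _ _ _ b) ?(ltnW bam) //= lerDl sumr_ge0.
rewrite /norm1 -(sum_shift (fun u => `|F u|) g) -(sum_period _ a) [leRHS]big_mkcond /=.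
by apply: ler_sum => n _; rewrite /on_nat; case: ifP => _; rewrite ?normr0.
Qed.

Lemma on_nat_weighted_bound F g (w : nat -> R) a b : \sum_u F u = 0 ->
  (forall n, (a <= n)%N -> w n.+1 <= w n) -> (forall n, 0 <= w n) ->
  `|\sum_(a <= n < b) on_nat F g n * w n| <= norm1 F * w a.
Proof. by move=> F0 dw w0; apply: abel_bound => // c; apply: on_nat_sum_bound. Qed.

Lemma invn_decr (n : nat) : (0 < n)%N -> n.+1%:R^-1 <= n%:R^-1 :> R.
Proof. by move=> n0; rewrite lef_pV2 ?posrE ?ltr0n // ler_nat. Qed.

Lemma invn_ge0 (n : nat) : 0 <= n%:R^-1 :> R.
Proof. by rewrite invr_ge0 ler0n. Qed.

(** These functions span the functions of mean zero, so finitely many convergent series determine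
    all the others by linearity. *)
Definition delta_avg u g : R := (g == u)%:R - #|G|%:R^-1.

Lemma cardG_gt0 : 0 < #|G|%:R :> R.
Proof. by rewrite ltr0n; apply/card_gt0P; exists 1%g. Qed.

Lemma sum_inv_card : \sum_(g : G) #|G|%:R^-1 = 1 :> R.
Proof. by rewrite sumr_const -[LHS]mulr_natl mulfV // gt_eqF // cardG_gt0. Qed.

Lemma sum_delta u (c : G -> R) : \sum_g (g == u)%:R * c g = c u.
Proof.
rewrite (bigD1 u) //= eqxx mul1r big1 ?addr0 // => g /negbTE ->.
by rewrite mul0r.
Qed.

Lemma sum_delta_avg u : \sum_g delta_avg u g = 0.
Proof.
rewrite sumrB sum_inv_card; under eq_bigr => g _ do rewrite -[_%:R]mulr1.
by rewrite (sum_delta u (fun=> 1)) subrr.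
Qed.

Lemma exists_ell : exists (ell : G -> R) (C : R), 0 <= C /\
  forall u n, `|\sum_(1 <= i < n.+1) on_nat (delta_avg u) 1 i * i%:R^-1 - ell u|
    <= C / n.+1%:R.
Proof.
have H u : exists l, forall n,
    `|\sum_(1 <= i < n.+1) on_nat (delta_avg u) 1 i * i%:R^-1 - l|
      <= norm1 (delta_avg u) / n.+1%:R.
  apply: cauchy_rate_limit => n p np.
  rewrite (@big_cat_nat _ _ _ n.+1 1 p.+1) //= addrAC subrr add0r.
  apply: (@on_nat_weighted_bound (delta_avg u) 1 (fun n : nat => n%:R^-1)).
  - exact: sum_delta_avg.
  - by move=> i ni; apply: invn_decr; apply: leq_trans ni.
  - exact: invn_ge0.
have [ell Hell] := fin_all_exists H.
exists ell, (\sum_u norm1 (delta_avg u)); split; first by apply: sumr_ge0 => u _; apply: norm1_ge0.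
move=> u n; apply: le_trans (Hell u n) _; rewrite ler_wpM2r ?invn_ge0 //.
by rewrite (bigD1 u) //= lerDl sumr_ge0 // => v _; apply: norm1_ge0.
Qed.

Section Ell.
Variables (ell : G -> R) (Cl : R).
Hypothesis Cl_ge0 : 0 <= Cl.
Hypothesis ellP : forall u n,
  `|\sum_(1 <= i < n.+1) on_nat (delta_avg u) 1 i * i%:R^-1 - ell u| <= Cl / n.+1%:R.

(* For F of mean zero, Lser F g is the value of the series of F (g * cls n) / n over n coprime to m. *)
Definition Lser F g : R := \sum_u F (g * u)%g * ell u.
(** The transpose of the operator [Lser]. *)
Definition LserT F g : R := \sum_u F (g * u^-1)%g * ell u.

Lemma small_eq0 (t C : R) : (forall n, `|t| <= C / n.+1%:R) -> t = 0.
Proof.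
move=> H; apply/eqP; rewrite -normr_le0 leNgt; apply/negP => t0.
have C0 : 0 <= C by have := H 0%N; rewrite divr1; apply: le_trans.
have := archi_boundP (divr_ge0 C0 (ltW t0)); set K := Num.Def.archi_bound _.
rewrite ltr_pdivrMr // => HK; have := H K.
rewrite ler_pdivlMr ?ltr0n // -natr1; nra.
Qed.

Lemma sum_ell : \sum_u ell u = 0.
Proof.
apply: (@small_eq0 _ (#|G|%:R * Cl)) => n.
have E : \sum_u \sum_(1 <= i < n.+1) on_nat (delta_avg u) 1 i * i%:R^-1 = 0.
  rewrite exchange_big /= big1 // => i _; rewrite -mulr_suml /on_nat.
  case: (coprime m i); last by rewrite big1 ?mul0r.
  rewrite /delta_avg sumrB sum_inv_card.
  under eq_bigr => u _ do rewrite eq_sym -[_%:R]mulr1.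
  by rewrite (sum_delta _ (fun=> 1)) subrr mul0r.
rewrite -normrN -sub0r -{1}E -sumrB; apply: le_trans (ler_norm_sum _ _ _) _.
apply: (@le_trans _ _ (\sum_(u : G) Cl / n.+1%:R)); first by apply: ler_sum.
by rewrite sumr_const -mulrA mulr_natl.
Qed.

Lemma Lser_approx F g n : \sum_u F u = 0 ->
  `|\sum_(1 <= i < n.+1) on_nat F g i * i%:R^-1 - Lser F g| <= norm1 F * Cl / n.+1%:R.
Proof.
move=> F0.
have E i : on_nat F g i = \sum_u F (g * u)%g * on_nat (delta_avg u) 1 i.
  rewrite /on_nat; case: (coprime m i); last by rewrite big1 // => u _; rewrite mulr0.
  under eq_bigr => u _ do rewrite /delta_avg mulrBr mul1g [X in X - _]mulrC eq_sym.
  rewrite sumrB -mulr_suml sum_shift F0 mul0r subr0.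
  by rewrite (sum_delta _ (fun u => F (g * u)%g)).
under eq_bigr => i _ do rewrite E mulr_suml.
rewrite exchange_big /= /Lser -sumrB; apply: le_trans (ler_norm_sum _ _ _) _.
rewrite -mulrA /norm1 -(sum_shift (fun u => `|F u|) g) mulr_suml.
apply: ler_sum => u _.
under eq_bigr => i _ do rewrite -mulrA.
by rewrite -mulr_sumr -mulrBr normrM ler_wpM2l.
Qed.

Lemma inv_floor_le x d : (0 < x)%N -> (0 < d)%N -> (x %/ d).+1%:R^-1 <= d%:R / x%:R :> R.
Proof.
move=> x0 d0; rewrite ler_pdivlMr ?ltr0n // mulrC ler_pdivrMr ?ltr0n //.
by rewrite -natrM ler_nat mulnC ltnW // ltn_ceil.
Qed.

Definition mangoldt_sum F x g : R := \sum_(1 <= d < x.+1) mangoldt R d / d%:R * on_nat F g d.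

(** For n = d e the shift of [g] by [cls d] replaces the factor chi(d) that a character would
    release. *)
Lemma sum_on_nat_exchange F g x (w : nat -> nat -> R) :
  \sum_(1 <= n < x.+1) (\sum_(d <- divisors n) w d (n %/ d)%N) * (on_nat F g n / n%:R)
  = \sum_(1 <= d < x.+1) if coprime m d then
      \sum_(1 <= e < (x %/ d).+1) w d e / d%:R * (on_nat F (g * cls d)%g e / e%:R) else 0.
Proof.
transitivity (\sum_(1 <= n < x.+1) \sum_(d <- divisors n)
    w d (n %/ d)%N * (on_nat F g (d * (n %/ d)) / (d * (n %/ d))%:R)).
  apply: eq_big_nat => n /andP[n0 _]; rewrite mulr_suml !big_seq; apply: eq_bigr => d.
  by rewrite -dvdn_divisors // => dn; rewrite [(d * _)%N]mulnC divnK.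
rewrite (sum_divisors_exchange x (fun d e => w d e * (on_nat F g (d * e) / (d * e)%:R))).
apply: eq_bigr => d _; case cd: (coprime m d); last first.
  by rewrite big1 // => e _; rewrite on_natM cd mul0r mulr0.
by apply: eq_bigr => e _; rewrite on_natM cd natrM invfM; ring.
Qed.

(** It suffices that n (ln (n+1) - ln n) <= 1 <= ln n. Starting at 4 lets the crude bound ln 2 >=
    1/2 suffice; the later summations by parts with this weight start at 4 too. *)
Lemma ln_div_decr (n : nat) : (4 <= n)%N -> ln n.+1%:R / n.+1%:R <= ln n%:R / n%:R :> R.
Proof.
move=> n4; have n0 : 0 < n%:R :> R by rewrite ltr0n; apply: leq_trans n4.
rewrite ler_pdivrMr ?ltr0n // mulrAC ler_pdivlMr //.
have ln2 : 1 / 2 <= ln 2 :> R.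
  have : -1 < - (2^-1) :> R by lra.
  move=> /le_ln1Dx; rewrite (_ : 1 + - 2^-1 = 2^-1); last by lra.
  by rewrite lnV ?posrE; lra.
have ln4 : 1 <= ln n%:R :> R.
  apply: le_trans (ler_ln_nat R (isT : 0 < 4)%N n4).
  by rewrite (natrM R 2 2) lnM ?posrE; lra.
have := lnS_sub R (leq_trans (isT : 0 < 4)%N n4).
rewrite -(ler_pM2l n0) divff ?gt_eqF //; set l := ln n%:R in ln4 *; set l' := ln _.
rewrite -natr1; nra.
Qed.

Lemma sum_ln_bound F : \sum_u F u = 0 ->
  exists C, forall g x, `|\sum_(1 <= n < x.+1) on_nat F g n * (ln n%:R / n%:R)| <= C.
Proof.
move=> F0; pose w (n : nat) : R := ln n%:R / n%:R.
have w0 n : 0 <= w n by rewrite divr_ge0 ?ln_nat_ge0.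
have fw g n : `|on_nat F g n * w n| <= norm1 F * w n.
  by rewrite normrM (ger0_norm (w0 n)) ler_wpM2r // on_nat_le.
exists (\sum_(1 <= n < 4) norm1 F * w n + norm1 F * w 4) => g x.
have [x4|x4] := leqP 4 x.+1.
  rewrite (@big_cat_nat _ _ _ 4) //=; apply: le_trans (ler_normD _ _) _; apply: lerD.
    by apply: le_trans (ler_norm_sum _ _ _) _; apply: ler_sum => n _; apply: fw.
  exact: (on_nat_weighted_bound g x.+1 F0 ln_div_decr w0).
apply: le_trans (ler_norm_sum _ _ _) _; rewrite -[leLHS]addr0; apply: lerD; last first.
  by rewrite mulr_ge0 ?norm1_ge0.
rewrite [leRHS](@big_cat_nat _ _ _ x.+1) ?(ltnW x4) //= -[leLHS]addr0; apply: lerD.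
  by apply: ler_sum => n _; apply: fw.
by apply: sumr_ge0 => n _; rewrite mulr_ge0 ?norm1_ge0.
Qed.

(** As ln is the convolution of [mangoldt] and 1, the bounded sum of F(g n) ln n / n splits over n =
    d e. The sum over e is a partial sum of the series [Lser F] at g cls d, off by O(d / x); the
    errors total O(psi x / x), whence the 12. *)
Lemma mangoldt_sum_Lser_bound F : \sum_u F u = 0 ->
  exists C, forall x g, `|mangoldt_sum (Lser F) x g| <= C.
Proof.
move=> F0; have [C HC] := sum_ln_bound F0.
exists (C + 12 * (norm1 F * Cl)) => x g.
have [x0|x0] := posnP x.
  rewrite x0 /mangoldt_sum big_geq // normr0 addr_ge0 ?mulr_ge0 ?norm1_ge0 //.
  exact: le_trans (HC g 0%N).
have x0' : 0 < x%:R :> R by rewrite ltr0n.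
pose S := \sum_(1 <= n < x.+1) on_nat F g n * (ln n%:R / n%:R).
suff : `|S - mangoldt_sum (Lser F) x g| <= 12 * (norm1 F * Cl).
  by have := HC g x; rewrite -/S !ler_norml => /andP[? ?] /andP[? ?]; apply/andP; split; lra.
have -> : S = \sum_(1 <= n < x.+1) (\sum_(d <- divisors n) mangoldt R d) * (on_nat F g n / n%:R).
  by apply: eq_big_nat => n /andP[n0 _]; rewrite sum_mangoldt //; ring.
rewrite (sum_on_nat_exchange F g x (fun d _ => mangoldt R d)) /mangoldt_sum -sumrB.
apply: le_trans (ler_norm_sum _ _ _) _.
have nc : 0 <= norm1 F * Cl by rewrite mulr_ge0 ?norm1_ge0.
apply: (@le_trans _ _ (\sum_(1 <= d < x.+1) mangoldt R d * (norm1 F * Cl / x%:R))); last first.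
  rewrite -mulr_suml mulrA ler_pdivrMr // [leRHS]mulrAC.
  by apply: ler_wpM2r (psi_le R x).
rewrite [leLHS]big_nat_cond [leRHS]big_nat_cond; apply: ler_sum => d.
rewrite andbT => /andP[d0 _].
have m0 := mangoldt_ge0 R d; have d0' : 0 < d%:R :> R by rewrite ltr0n.
rewrite [X in _ - _ * X]/on_nat; case: ifP => _; last first.
  by rewrite mulr0 subrr normr0 mulr_ge0 // divr_ge0 // ltW.
rewrite -mulr_sumr -mulrBr normrM ger0_norm; last by rewrite divr_ge0 // ltW.
rewrite -[leLHS]mulrA ler_wpM2l // [leLHS]mulrC ler_pdivrMr //.
apply: le_trans (Lser_approx (g * cls d)%g (x %/ d) F0) _.
by rewrite -!mulrA ler_wpM2l ?norm1_ge0 // ler_wpM2l // mulrC inv_floor_le.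
Qed.

(** Since ln is additive, the sum [D] acts as a derivation: on coprime a, b it is D(a) [b = 1] +
    [a = 1] D(b). It therefore lives on prime powers, where only the divisor p counts. *)
Lemma sum_moebius_ln n : (0 < n)%N ->
  \sum_(d <- divisors n) moebius R d * ln d%:R = - mangoldt R n.
Proof.
pose D n := \sum_(d <- divisors n) moebius R d * ln d%:R.
have DM a b : (0 < a)%N -> (0 < b)%N -> coprime a b ->
    D (a * b)%N = D a * (b == 1%N)%:R + (a == 1%N)%:R * D b.
  move=> a0 b0 cab; rewrite -(sum_moebius _ a0) -(sum_moebius _ b0) /D.
  rewrite (perm_big _ (divisors_coprime a0 b0 cab)) big_allpairs_dep /=.
  rewrite !big_distrlr /= -big_split /= !big_seq; apply: eq_bigr => d da.
  rewrite -big_split /= !big_seq; apply: eq_bigr => e eb.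
  move: da eb; rewrite -!dvdn_divisors // => da eb.
  have d0 := dvdn_gt0 a0 da; have e0 := dvdn_gt0 b0 eb.
  rewrite moebiusM //; last by apply: coprime_dvdl da _; apply: coprime_dvdr eb _.
  rewrite natrM lnM ?posrE ?ltr0n //; ring.
have Dp p a : prime p -> (0 < a)%N -> D (p ^ a)%N = - ln p%:R.
  case: a => // a pp _; rewrite /D (perm_big _ (divisors_pfactor a.+1 pp)) big_map.
  rewrite -[iota 0 _]/(index_iota 0 a.+2) big_nat_recl // big_nat_recl // big1_seq.
    by rewrite /= addr0 expn0 ln1 mulr0 moebius_pfactor // expn1 /= add0r mulN1r.
  by move=> i _; rewrite moebius_pfactor // mul0r.
rewrite -/(D n); move: n; apply: prime_power_ind => [|p a n pp a0 n0 cp _].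
  by rewrite /D big_seq1 ln1 mulr0 oppr0.
have pa1 : (1 < p ^ a)%N by rewrite -[1%N](exp1n a) ltn_exp2r // prime_gt1.
rewrite DM ?(ltnW pa1) // Dp // (gtn_eqF pa1) mul0r addr0.
have [->|n1] := eqVneq n 1%N; first by rewrite mulr1 muln1 mangoldt_pfactor.
by rewrite mulr0 mangoldt_coprime ?oppr0 // ltn_neqAle eq_sym n1.
Qed.

Lemma norm_moebius_le1 n : `|moebius R n| <= 1.
Proof. by rewrite /moebius; case: ifP; rewrite ?normr0 // normrX normrN1 expr1n. Qed.

(* The function Lambda(n) + ln x [n = 1] is the Dirichlet convolution of moebius and ln (x / d),
   and L F = 0 makes the inner sums O(d / x). *)
Lemma mangoldt_sum_ker_bound F : \sum_u F u = 0 -> (forall g, Lser F g = 0) ->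
  exists C, forall x g, (0 < x)%N -> `|mangoldt_sum F x g + ln x%:R * F g| <= C.
Proof.
move=> F0 LF; exists (norm1 F * Cl) => x g x0; have x0' : 0 < x%:R :> R by rewrite ltr0n.
have -> : mangoldt_sum F x g + ln x%:R * F g = \sum_(1 <= n < x.+1)
   (\sum_(d <- divisors n) moebius R d * (ln x%:R - ln d%:R)) * (on_nat F g n / n%:R).
  transitivity (\sum_(1 <= n < x.+1)
     (ln x%:R * (n == 1%N)%:R + mangoldt R n) * (on_nat F g n / n%:R)).
    under [RHS]eq_bigr => n _ do rewrite mulrDl.
    rewrite big_split /= addrC; congr (_ + _).
      by apply: eq_bigr => n _; ring.
    rewrite big_ltn // eqxx mulr1 on_nat1 divr1 big_nat_cond big1 ?addr0 //.
    by move=> n /andP[/andP[n1 _] _]; rewrite (gtn_eqF n1) mulr0 mul0r.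
  apply: eq_big_nat => n /andP[n0 _]; congr (_ * _).
  under [RHS]eq_bigr => d _ do rewrite mulrBr.
  by rewrite sumrB -mulr_suml sum_moebius // sum_moebius_ln // opprK mulrC.
rewrite (sum_on_nat_exchange F g x (fun d _ => moebius R d * (ln x%:R - ln d%:R))).
apply: le_trans (ler_norm_sum _ _ _) _.
have nc : 0 <= norm1 F * Cl by rewrite mulr_ge0 ?norm1_ge0.
apply: (@le_trans _ _ (\sum_(1 <= d < x.+1) (ln x%:R - ln d%:R) * (norm1 F * Cl / x%:R))); last first.
  (* By [ln_fact_ge] the sum of ln (x / d) over d <= x is at most x, which cancels the factor 1 /
     x. *)
  rewrite -mulr_suml mulrA ler_pdivrMr // mulrC ler_wpM2l //.
  rewrite sumrB sumr_const_nat subn1 /= -[_ *+ x]mulr_natl.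
  by have := ln_fact_ge R x; lra.
rewrite [leLHS]big_nat_cond [leRHS]big_nat_cond; apply: ler_sum => d.
rewrite andbT => /andP[d0 dx].
have d0' : 0 < d%:R :> R by rewrite ltr0n.
have ll : 0 <= ln x%:R - ln d%:R :> R by rewrite subr_ge0 ler_ln_nat.
case: ifP => _; last by rewrite normr0 mulr_ge0 // divr_ge0 // ltW.
rewrite -mulr_sumr !normrM (ger0_norm ll) normfV (gtr0_norm d0').
have h := Lser_approx (g * cls d)%g (x %/ d) F0; rewrite LF subr0 in h.
set s := `|\sum_(_ <= _ < _) _| in h *.
have mu1 := norm_moebius_le1 d.
apply: (@le_trans _ _ (1 * (ln x%:R - ln d%:R) / d%:R * s)).
  by do 2!(apply: ler_wpM2r; first by rewrite ?normr_ge0 ?invn_ge0); apply: ler_wpM2r.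
rewrite mul1r -[leLHS]mulrA ler_wpM2l // [leLHS]mulrC ler_pdivrMr //.
apply: le_trans h _; rewrite -!mulrA ler_wpM2l ?norm1_ge0 // ler_wpM2l //.
by rewrite mulrC inv_floor_le.
Qed.

Lemma sum_mx_col (r : 'rV[R]_#|G|) (c : G -> R) :
  \sum_i r 0 i * c (enum_val i) = \sum_h r 0 (enum_rank h) * c h.
Proof.
rewrite (reindex (@enum_rank G)); last by apply: onW_bij; apply: enum_rank_bij.
by apply: eq_bigr => h _; rewrite enum_rankK.
Qed.

Lemma sum_conv (F c : G -> R) : \sum_g \sum_u F (g * u^-1)%g * c u = (\sum_g F g) * \sum_u c u.
Proof.
rewrite exchange_big /= mulr_sumr; apply: eq_bigr => u _; rewrite -mulr_suml; congr (_ * _).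
by rewrite [RHS](reindex_inj (mulIg u^-1%g)).
Qed.

(** The matrix of [Lser] is normal because G is commutative, so the indicator of 1 is [Lser f] plus
    a vector killed by [Lser] and [LserT]. Constants are killed as well since [ell] sums to 0, so
    the mean 1/|G| can be split off that vector. [f] has mean zero as a value of [LserT]. *)
Lemma exists_decomposition : exists f y : G -> R,
  [/\ \sum_g f g = 0, \sum_g y g = 0,
      forall g, (g == 1%g)%:R = #|G|%:R^-1 + Lser f g + y g,
      forall g, Lser y g = 0 & forall g, LserT y g = 0].
Proof.
pose A : 'M[R]_#|G| := \matrix_(i, j) ell ((enum_val j)^-1 * enum_val i)%g.
pose fr (r : 'rV[R]_#|G|) g := r 0 (enum_rank g).
have AE r j : (r *m A) 0 j = Lser (fr r) (enum_val j).
  rewrite mxE; under eq_bigr => i _ do rewrite [A _ _]mxE.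
  rewrite (sum_mx_col r (fun h => ell ((enum_val j)^-1 * h)%g)).
  rewrite (reindex_inj (mulgI (enum_val j))) /Lser; apply: eq_bigr => u _.
  by rewrite mulKg.
have ATE r j : (r *m A^T) 0 j = LserT (fr r) (enum_val j).
  rewrite mxE; under eq_bigr => i _ do rewrite !mxE.
  rewrite (sum_mx_col r (fun h => ell (h^-1 * enum_val j)%g)).
  rewrite (reindex_inj (inj_comp (mulgI (enum_val j)) invg_inj)) /LserT.
  by apply: eq_bigr => u _ /=; rewrite invMg invgK mulgKV.
have normA : A^T *m A = A *m A^T.
  apply/matrixP => i j; rewrite !mxE.
  under eq_bigr => l _ do rewrite !mxE.
  under [RHS]eq_bigr => l _ do rewrite !mxE.
  set a := enum_val i; set b := enum_val j.
  rewrite (reindex (@enum_rank G)); last by apply: onW_bij; apply: enum_rank_bij.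
  rewrite [RHS](reindex (@enum_rank G)) /=; last first.
    by apply: onW_bij; apply: enum_rank_bij.
  (* The substitution of a b h^-1 for h exchanges the two matrix products, by commutativity. *)
  rewrite (reindex_inj (inj_comp (mulgI (a * b)%g) invg_inj)) /=.
  apply: eq_bigr => h _; rewrite !enum_rankK -!mulgA mulKg.
  rewrite [(b * h^-1)%g]mulGC mulrC; congr (ell _ * _).
  by rewrite (mulGC b^-1%g) -!mulgA mulgV mulg1 mulGC.
have [z [w [dE wA wAT]]] := normal_decomposition normA (\row_j (enum_val j == 1%g)%:R).
pose f g := fr (z *m A^T) g; pose y g := fr w g - #|G|%:R^-1.
have fE g : f g = LserT (fr z) g by rewrite /f /fr ATE enum_rankK.
have f0 : \sum_g f g = 0.
  under eq_bigr => g _ do rewrite fE.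
  by rewrite sum_conv sum_ell mulr0.
have decomp g : (g == 1%g)%:R = Lser f g + fr w g.
  have := congr1 (fun r : 'rV[R]_#|G| => r 0 (enum_rank g)) dE.
  by rewrite [LHS]mxE enum_rankK [RHS]mxE AE enum_rankK.
have sumLser F : \sum_g Lser F g = 0.
  rewrite /Lser exchange_big /=; transitivity (\sum_u (\sum_g F g) * ell u).
    apply: eq_bigr => u _; rewrite -mulr_suml; congr (_ * _).
    by rewrite [RHS](reindex_inj (mulIg u)).
  by rewrite -mulr_sumr sum_ell mulr0.
exists f, y; split=> //.
- have : \sum_(g : G) (g == 1%g)%:R = 1 :> R.
    by rewrite (bigD1 1%g) //= eqxx big1 ?addr0 // => g /negbTE ->.
  under eq_bigr => g _ do rewrite decomp.
  by rewrite big_split /= sumLser add0r /y sumrB sum_inv_card => ->; rewrite subrr.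
- by move=> g; rewrite /y decomp; ring.
- move=> g; rewrite /Lser /y; under eq_bigr => u _ do rewrite mulrBl.
  rewrite sumrB -mulr_sumr sum_ell mulr0 subr0.
  have := congr1 (fun r : 'rV[R]_#|G| => r 0 (enum_rank g)) wA.
  by rewrite AE enum_rankK mxE.
move=> g; rewrite /LserT /y; under eq_bigr => u _ do rewrite mulrBl.
rewrite sumrB -mulr_sumr sum_ell mulr0 subr0.
have := congr1 (fun r : 'rV[R]_#|G| => r 0 (enum_rank g)) wAT.
by rewrite ATE enum_rankK mxE.
Qed.

(* y is the projection of the indicator of 1 on the kernel, so it equals its own autocorrelation.
   When y 1 = 1/|G|, Cauchy-Schwarz is an equality and every translate of y is y or - y. *)
Section Dichotomy.
Variables (f y : G -> R).
Hypothesis y_sum0 : \sum_g y g = 0.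
Hypothesis decomp : forall g, (g == 1%g)%:R = #|G|%:R^-1 + Lser f g + y g.
Hypothesis Ly : forall g, Lser y g = 0.
Hypothesis LTy : forall g, LserT y g = 0.

(** Pair a translate of y with the indicator of 1, expanded by [decomp]: the constant drops out as y
    has mean zero, and the [Lser f] part because transposition turns it into values of [LserT y]. *)
Lemma y_autocorrelation h : \sum_g y (h * g)%g * y g = y h.
Proof.
have <- : \sum_g (g == 1%g)%:R * y (h * g)%g = y h.
  by rewrite (sum_delta 1%g (fun g => y (h * g)%g)) mulg1.
under [RHS]eq_bigr => g _ do rewrite decomp mulrDl mulrDl.
rewrite !big_split /= -mulr_sumr sum_shift y_sum0 mulr0 add0r.
rewrite [X in _ = X + _](_ : _ = 0) ?add0r; first by apply: eq_bigr => g _; rewrite mulrC.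
rewrite /Lser; under eq_bigr => g _ do rewrite mulr_suml.
rewrite exchange_big /=.
transitivity (\sum_u \sum_v f v * ell u * y (h * (v * u^-1))%g).
  apply: eq_bigr => u _; rewrite [RHS](reindex_inj (mulIg u)) /=.
  by apply: eq_bigr => g _; rewrite mulgK.
rewrite exchange_big /= big1 // => v _.
transitivity (f v * LserT y (h * v)%g); last by rewrite LTy mulr0.
by rewrite /LserT mulr_sumr; apply: eq_bigr => u _; rewrite mulgA; ring.
Qed.

Lemma y1_sqr : \sum_g y g ^+ 2 = y 1%g.
Proof. by rewrite -[RHS]y_autocorrelation; apply: eq_bigr => g _; rewrite mul1g expr2. Qed.

Lemma shift_dist (c : R) h : c ^+ 2 = 1 ->
  \sum_g (y (h * g)%g - c * y g) ^+ 2 = 2 * (y 1%g - c * y h).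
Proof.
move=> c1.
transitivity (\sum_g (y (h * g)%g ^+ 2 + y g ^+ 2 - 2 * c * (y (h * g)%g * y g))).
  by apply: eq_bigr => g _; rewrite sqrrB exprMn c1; ring.
rewrite sumrB big_split /= (sum_shift (fun g => y g ^+ 2)) -mulr_sumr y1_sqr y_autocorrelation.
ring.
Qed.

Lemma norm_y_le h : `|y h| <= y 1%g.
Proof.
have sq_sum_ge0 (c : R) : 0 <= \sum_g (y (h * g)%g - c * y g) ^+ 2.
  by apply: sumr_ge0 => g _; apply: sqr_ge0.
have := sq_sum_ge0 1; have := sq_sum_ge0 (-1).
rewrite !shift_dist ?expr1n ?sqrrN ?expr1n // => h1 h2.
by rewrite ler_norml; apply/andP; split; lra.
Qed.

(** The alternative arises by summing y(g)^2 <= y(1)^2 over G: by [y1_sqr] this reads y(1) <= |G|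
    y(1)^2, so y(1) is 0 or at least 1/|G|. *)
Lemma y_real_character : y 1%g <= #|G|%:R^-1 -> (forall g, y g = 0) \/
  [/\ #|G|%:R * y 1%g = 1,
      forall h g, #|G|%:R * y (h * g)%g = (#|G|%:R * y h) * (#|G|%:R * y g)
    & forall g, #|G|%:R * y g = 1 \/ #|G|%:R * y g = -1].
Proof.
move=> yle; have cG := cardG_gt0.
have y1ge0 : 0 <= y 1%g by rewrite -y1_sqr; apply: sumr_ge0 => g _; apply: sqr_ge0.
have [y10|y1n0] := eqVneq (y 1%g) 0.
  by left=> g; apply/eqP; rewrite -normr_le0 -y10 norm_y_le.
right; have y1gt0 : 0 < y 1%g by rewrite lt_neqAle eq_sym y1n0.
have sq_le g : y g ^+ 2 <= y 1%g ^+ 2.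
  by rewrite -real_normK ?num_real // ler_pXn2r ?nnegrE ?normr_ge0 // norm_y_le.
have y1E : y 1%g = #|G|%:R^-1.
  apply/eqP; rewrite eq_le yle /= -[leLHS]mul1r ler_pdivrMr // mulrC.
  rewrite -(ler_pM2r y1gt0) mul1r -mulrA -expr2 -[leLHS]y1_sqr.
  apply: le_trans (ler_sum _ (fun g _ => sq_le g)) _.
  by rewrite sumr_const mulr_natl.
have sqE g : y g ^+ 2 = y 1%g ^+ 2.
  apply/eqP; rewrite eq_sym -subr_eq0; apply/eqP.
  have /psumr_eq0P : forall g, true -> 0 <= y 1%g ^+ 2 - y g ^+ 2.
    by move=> g' _; rewrite subr_ge0.
  apply=> //; rewrite sumrB y1_sqr sumr_const -[X in X - _]mulr_natl expr2 mulrA {1}y1E.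
  by rewrite divff ?gt_eqF // mul1r subrr.
have signs g : exists2 c : R, (c = 1 \/ c = -1) & y g = c * y 1%g.
  have /eqP := sqE g; rewrite eqf_sqr => /orP[] /eqP ->; first by exists 1; [left|rewrite mul1r].
  by exists (-1); [right|rewrite mulN1r].
have shiftE h c : (c = 1 \/ c = -1) -> y h = c * y 1%g -> forall g, y (h * g)%g = c * y g.
  move=> c1 hE g; have c2 : c ^+ 2 = 1 by case: c1 => ->; rewrite ?sqrrN expr1n.
  have := shift_dist h c2; rewrite hE mulrA -expr2 c2 mul1r subrr mulr0 => /psumr_eq0P H.
  apply/eqP; rewrite -subr_eq0 -sqrf_eq0; apply/eqP; apply: H => // i _; exact: sqr_ge0.
have cy1 : #|G|%:R * y 1%g = 1 by rewrite y1E divff // gt_eqF.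
split=> // [h g|g].
  have [c c1 hE] := signs h; rewrite (shiftE h c c1 hE) hE.
  by rewrite [_ * (c * y 1%g)]mulrCA cy1 mulr1 mulrCA.
by have [c [] -> ->] := signs g; rewrite ?mul1r ?mulN1r ?mulrN cy1; [left|right].
Qed.

Lemma not_real_character :
  #|G|%:R * y 1%g = 1 ->
  (forall h g, #|G|%:R * y (h * g)%g = (#|G|%:R * y h) * (#|G|%:R * y g)) ->
  (forall g, #|G|%:R * y g = 1 \/ #|G|%:R * y g = -1) -> False.
Proof.
move=> chi1 chiM chiV; pose chi g := #|G|%:R * y g.
have chi0 : \sum_g chi g = 0 by rewrite -mulr_sumr y_sum0 mulr0.
have Lchi g : Lser chi g = 0.
  rewrite /Lser; under eq_bigr => u _ do rewrite -mulrA.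
  by rewrite -mulr_sumr -/(Lser y g) Ly mulr0.
apply: (@no_vanishing_real_character R (on_nat chi 1%g) (norm1 chi) (norm1 chi * Cl)).
- by rewrite on_nat1.
- move=> a b; rewrite on_natM // /on_nat.
  case: (coprime m a); last by rewrite mul0r.
  by case: (coprime m b); rewrite ?mulr0 // !mul1g /chi chiM.
- move=> n; rewrite /on_nat; case: ifP => _; last by apply: Or31.
  by case: (chiV (1 * cls n)%g) => E; [apply: Or32|apply: Or33].
- by move=> a b; apply: on_nat_sum_bound.
move=> n; have := Lser_approx 1%g n chi0.
by rewrite Lchi subr0.
Qed.

End Dichotomy.

Lemma mangoldt_sum_one_le x g : (0 < x)%N -> mangoldt_sum (fun=> 1) x g <= ln x%:R + 12 :> R.
Proof.
move=> x0; apply: le_trans (mertens_le R x0); apply: ler_sum => d _.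
have h : 0 <= mangoldt R d / d%:R by rewrite divr_ge0 ?mangoldt_ge0.
by rewrite /on_nat; case: ifP; rewrite ?mulr1 ?mulr0.
Qed.

(** Compared with the full Mertens sum, only d not coprime to m are lost: non-primes cost at most 2,
    and primes dividing m are at most m. *)
Lemma mangoldt_sum_one_ge : exists C : R, forall x g, (0 < x)%N ->
  ln x%:R - C <= mangoldt_sum (fun=> 1) x g.
Proof.
pose a d : R := mangoldt R d / d%:R.
have a0 d : 0 <= a d by rewrite divr_ge0 ?mangoldt_ge0.
exists (1 + 2 + \sum_(1 <= d < m.+1) a d) => x g x0.
have h1 := mertens_ge R x0; have h2 := mertens_nonprime R x.
have h3 : \sum_(1 <= d < x.+1 | (d < m.+1)%N) a d <= \sum_(1 <= d < m.+1) a d.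
  rewrite [leRHS](big_nat_widen _ _ (x + m).+1) ?ltnS ?leq_addl //.
  rewrite [leRHS](@big_cat_nat _ _ _ x.+1) ?ltnS ?leq_addr //= lerDl.
  by apply: sumr_ge0 => d _.
have : \sum_(1 <= d < x.+1) a d <= mangoldt_sum (fun=> 1) x g
    + \sum_(1 <= d < x.+1 | ~~ prime d) a d + \sum_(1 <= d < x.+1 | (d < m.+1)%N) a d.
  rewrite /mangoldt_sum big_mkcond [\sum_(_ <= _ < _ | ~~ _) _]big_mkcond.
  rewrite [\sum_(_ <= _ < _ | (_ < _)%N) _]big_mkcond -!big_split /=.
  apply: ler_sum => d _; have := a0 d; rewrite -/(a d) /on_nat.
  case: ifP => cd; first by case: ifP; case: ifP; lra.
  case: ifP => pd; first by case: ifP; lra.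
  rewrite mulr0; case: ifP => dm; first lra.
  have {}pd : prime d by apply/negPn; rewrite pd.
  have /dvdn_leq : (d %| m)%N.
    by apply: contraFT cd => /negPf dm'; rewrite coprime_sym prime_coprime // dm'.
  by move=> /(_ m_gt0); rewrite -ltnS dm.
rewrite /a in h1 h2 h3 *; lra.
Qed.

Lemma le0_of_ln_bound (t K : R) : (forall x, (0 < x)%N -> ln x%:R * t <= K) -> t <= 0.
Proof.
move=> H; rewrite leNgt; apply/negP => t0.
have [n n0] := ln_unbounded (K / t); rewrite ltr_pdivrMr // => Kn.
by have := H n n0; rewrite leNgt Kn.
Qed.

Lemma mangoldt_sum_delta_ge0 x g : 0 <= mangoldt_sum (fun u => (u == 1%g)%:R) x g :> R.
Proof.
apply: sumr_ge0 => d _; rewrite mulr_ge0 // ?divr_ge0 ?mangoldt_ge0 // /on_nat.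
by case: ifP.
Qed.

(** The decomposition makes the sum equal to (1/|G| - y g) ln x + O(1). At g = 1 it is nonnegative
    for all x, which yields the bound y 1 <= 1/|G| needed for the dichotomy; y then vanishes, since
    a real character with vanishing series is excluded. *)
Lemma mangoldt_sum_delta_asymp : exists C : R, forall x g, (0 < x)%N ->
  #|G|%:R^-1 * ln x%:R - C <= mangoldt_sum (fun u => (u == 1%g)%:R) x g.
Proof.
have [f [y [f0 y0 dec Ly LTy]]] := exists_decomposition.
have [C1 HC1] := mangoldt_sum_Lser_bound f0.
have [C2 HC2] := mangoldt_sum_ker_bound y0 Ly.
have [C3 HC3] := mangoldt_sum_one_ge.
have TE x g : mangoldt_sum (fun u => (u == 1%g)%:R) x g
    = #|G|%:R^-1 * mangoldt_sum (fun=> 1) x g + mangoldt_sum (Lser f) x g + mangoldt_sum y x g.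
  rewrite /mangoldt_sum mulr_sumr -!big_split /=; apply: eq_bigr => d _.
  by rewrite /on_nat; case: ifP => _; rewrite ?dec; ring.
have cG : 0 < #|G|%:R^-1 :> R by rewrite invr_gt0 cardG_gt0.
have yle : y 1%g <= #|G|%:R^-1.
  rewrite -subr_le0; apply: (@le0_of_ln_bound _ (#|G|%:R^-1 * 12 + C1 + C2)) => x x0.
  have := mangoldt_sum_delta_ge0 x 1%g; rewrite TE => h.
  have := HC1 x 1%g; have := HC2 x 1%g x0; rewrite !ler_norml => /andP[_ h2] /andP[_ h1].
  have := ler_wpM2l (ltW cG) (mangoldt_sum_one_le 1%g x0); nra.
have y_eq0 g : y g = 0.
  have [//|[chi1 chiM chiV]] := y_real_character y0 dec LTy yle.
  by case: (not_real_character y0 Ly chi1 chiM chiV).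
exists (#|G|%:R^-1 * C3 + C1) => x g x0; rewrite TE.
have -> : mangoldt_sum y x g = 0.
  by rewrite /mangoldt_sum big1 // => d _; rewrite /on_nat; case: ifP; rewrite ?y_eq0 mulr0.
have := HC1 x g; rewrite ler_norml => /andP[h1 _].
have := ler_wpM2l (ltW cG) (HC3 x g x0); nra.
Qed.

End Ell.

Theorem dirichlet_mangoldt : exists C : R, forall x h, (0 < x)%N ->
  #|G|%:R^-1 * ln x%:R - C
    <= \sum_(1 <= d < x.+1 | coprime m d && (cls d == h)) mangoldt R d / d%:R.
Proof.
have [ell [Cl [Cl0 ellP]]] := exists_ell.
have [C HC] := mangoldt_sum_delta_asymp Cl0 ellP.
exists C => x h x0; apply: le_trans (HC x h^-1%g x0) _.
rewrite [leRHS]big_mkcond /mangoldt_sum; apply: ler_sum => d _.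
rewrite /on_nat; case: ifP => cd /=; last by rewrite mulr0.
rewrite (_ : (h^-1 * cls d == 1)%g = (cls d == h)); first by case: eqP; rewrite ?mulr1 ?mulr0.
by rewrite -[RHS](inj_eq (mulgI h^-1%g)) mulVg.
Qed.

End Dirichlet.

(** * Reduction to the unit group modulo m *)

Section UnitClass.
Variable (m : nat).
Hypothesis m_gt1 : (1 < m)%N.

(** The default 1 is taken at n not coprime to m; the sums using this map are restricted to n
    coprime to m. *)
Definition unit_class (n : nat) : {unit 'Z_m} := insubd (1%g : {unit 'Z_m}) (n%:R : 'Z_m).

Lemma val_unit_class n : coprime m n -> val (unit_class n) = n%:R.
Proof. by move=> cn; rewrite /unit_class insubdK // unfold_in /= unitZpE. Qed.

Lemma unit_classM a b : coprime m a -> coprime m b ->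
  unit_class (a * b) = (unit_class a * unit_class b)%g.
Proof.
move=> ca cb; apply: val_inj; rewrite val_unit_class ?coprimeMr ?ca //.
by rewrite /= !val_unit_class // natrM.
Qed.

Lemma unit_class_eq a b : coprime m a -> coprime m b ->
  (unit_class a == unit_class b) = (a == b %[mod m]).
Proof.
move=> ca cb; rewrite -(inj_eq val_inj) !val_unit_class // -(inj_eq val_inj) /=.
by rewrite !val_Zp_nat.
Qed.

Lemma sum_unit_class0 (R : nmodType) (F : {unit 'Z_m} -> R) :
  \sum_(i < m | coprime m i) F (unit_class i) = \sum_g F g.
Proof.
have zlt (z : 'Z_m) : (z < m)%N by rewrite -[X in (_ < X)%N](Zp_cast m_gt1) ltn_ord.
have cop (g : {unit 'Z_m}) : coprime m (val g : 'Z_m).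
  by rewrite -unitZpE // natr_Zp; apply: (valP g).
rewrite (reindex_onto (fun g : {unit 'Z_m} => Ordinal (zlt (val g))) (fun i : 'I_m => unit_class i)) /=.
  have uc (g : {unit 'Z_m}) : unit_class (val g : 'Z_m) = g.
    by apply: val_inj; rewrite val_unit_class ?natr_Zp.
  apply: eq_big => [g|g _]; last by rewrite uc.
  by rewrite cop uc eqxx.
by move=> i ci; apply: val_inj; rewrite /= val_unit_class // val_Zp_nat // modn_small.
Qed.

Lemma sum_unit_class (R : nmodType) (F : {unit 'Z_m} -> R) (a : nat) :
  \sum_(a <= i < a + m | coprime m i) F (unit_class i) = \sum_g F g.
Proof.
elim: a => [|a <-]; last first.
  have am : (a < a + m)%N by rewrite -[X in (X < _)%N]addn0 ltn_add2l ltnW.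
  rewrite big_mkcond [RHS]big_mkcond addSn big_nat_recr //= [RHS]big_ltn //.
  rewrite addrC; congr (_ + _).
  have -> : coprime m (a + m) = coprime m a by rewrite -coprime_modr modnDr coprime_modr.
  case ca: (coprime m a) => //; congr F; apply/eqP.
  by rewrite unit_class_eq ?modnDr // -coprime_modr modnDr coprime_modr.
by rewrite add0n big_mkord sum_unit_class0.
Qed.

End UnitClass.

Lemma mulg_unitC (S : finComUnitRingType) : commutative (@mulg {unit S}).
Proof. by move=> x y; apply: val_inj; rewrite /= mulrC. Qed.

Lemma mertens_progression (R : realType) (m h : nat) : (1 < m)%N -> coprime m h ->
  exists C : R, forall x, (0 < x)%N -> (totient m)%:R^-1 * ln x%:R - C
    <= \sum_(1 <= p < x.+1 | prime p && (p == h %[mod m])) ln p%:R / p%:R.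
Proof.
move=> m1 ch; have m0 := ltnW m1.
have [C HC] := @dirichlet_mangoldt R _ m (unit_class m) (@mulg_unitC _) m0
  (unit_classM m1) (sum_unit_class m1 (R := R)).
have cG : #|{: {unit 'Z_m}}| = totient m.
  by rewrite -(card_units_Zp m0) cardsT.
exists (C + 2) => x x0; have := HC x (unit_class m h) x0; rewrite cG.
have := mertens_nonprime R x.
set A := \sum_(_ <= _ < _ | _) _; set B := \sum_(_ <= _ < _ | _) _; set D := \sum_(_ <= _ < _ | _) _.
suff : B <= D + A by lra.
rewrite /A /B /D big_mkcond [X in _ <= X + _]big_mkcond [X in _ <= _ + X]big_mkcond -big_split /=.
apply: ler_sum => d _.
have a0 : 0 <= mangoldt R d / d%:R by rewrite divr_ge0 ?mangoldt_ge0.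
case: ifP => [/andP[cd]|_]; last first.
  case pd: (prime d) => /=; last by rewrite add0r.
  by case: ifP; rewrite ?addr0 // divr_ge0 ?ln_nat_ge0.
rewrite unit_class_eq // => ->; case pd: (prime d) => /=; last by rewrite add0r.
by rewrite addr0 mangoldt_prime.
Qed.

(** * From logarithmic densities to prime counts *)

Section Counting.
Variable R : realType.
Implicit Types (f g w : nat -> R).

Lemma abel_compare f g w (a b : nat) :
  (forall n, (a <= n)%N -> w n.+1 <= w n) -> (forall n, 0 <= w n) ->
  (forall c, \sum_(a <= n < c) f n <= \sum_(a <= n < c) g n) ->
  \sum_(a <= n < b) f n * w n <= \sum_(a <= n < b) g n * w n.
Proof.
move=> dw w0 fg; have [ba|ab] := leqP b a; first by rewrite !big_geq.
rewrite [leLHS](abel_summation _ _ (ltnW ab)) [leRHS](abel_summation _ _ (ltnW ab)).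
apply: lerD; first by rewrite ler_wpM2r.
rewrite [leLHS]big_nat_cond [leRHS]big_nat_cond; apply: ler_sum => n.
by rewrite andbT => /andP[an _]; rewrite ler_wpM2r ?subr_ge0 ?dw.
Qed.

Definition count_upto (P : pred nat) (x : nat) : nat := count P (iota 1 x).

Lemma count_uptoE (P : pred nat) x : (count_upto P x)%:R = \sum_(1 <= n < x.+1) (P n)%:R :> R.
Proof.
rewrite /count_upto -sum1_count natr_sum big_mkcond /index_iota subn1 /=.
by apply: eq_bigr => n _; case: (P n).
Qed.

(* Otherwise Abel summation with the weight ln n / n would bound the sum of ln p / p over A by K
   times the same sum over the multiples M q of M with q prime, which is about K / M ln x. *)
Lemma prime_counting_gap (A : pred nat) (c C0 : R) (K C1 M : nat) : (0 < M)%N ->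
  (forall x, (0 < x)%N ->
    c * ln x%:R - C0 <= \sum_(1 <= p < x.+1 | prime p && A p) ln p%:R / p%:R) ->
  2 * K%:R / M%:R < c ->
  exists x, (K * count_upto prime (x %/ M) + C1 < count_upto (fun p => prime p && A p) x)%N.
Proof.
move=> M0 lowA Kc; have M0' : 0 < M%:R :> R by rewrite ltr0n.
have [[x Hx]|H] := boolp.pselect (exists x,
    (K * count_upto prime (x %/ M) + C1 < count_upto (fun p => prime p && A p) x)%N).
  by exists x.
exfalso.
have {}H x : (count_upto (fun p => prime p && A p) x <= K * count_upto prime (x %/ M) + C1)%N.
  by rewrite leqNgt; apply/negP => h; apply: H; exists x.
pose w (n : nat) : R := ln n%:R / n%:R.
have w0 n : 0 <= w n by rewrite divr_ge0 ?ln_nat_ge0.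
pose f (n : nat) : R := (prime n && A n)%:R.
pose g1 (n : nat) : R := if (M %| n)%N then (prime (n %/ M))%:R else 0.
(* The weight [w] decreases only from 4 on. The additive constant and the terms of [g1] below 4 are
   gathered into a point mass [C2] at 4. *)
pose C2 : R := C1%:R + K%:R * \sum_(1 <= n < 4) g1 n.
pose g (n : nat) : R := K%:R * g1 n + C2 * (n == 4)%:R.
have g1_ge0 n : 0 <= g1 n by rewrite /g1; case: ifP.
have g_sum_le a b a' b' (F : nat -> R) : (forall n, 0 <= F n) -> (a' <= a)%N -> (b <= b')%N ->
    \sum_(a <= n < b) F n <= \sum_(a' <= n < b') F n.
  move=> F0 aa bb; have [ba|/ltnW ab] := leqP b a; first by rewrite big_geq // sumr_ge0.
  rewrite [leRHS](big_cat_nat aa (leq_trans ab bb)) /= [X in _ <= _ + X](big_cat_nat ab bb) /=.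
  by rewrite addrCA lerDl addr_ge0 // sumr_ge0.
have sum4 (F : nat -> R) x : (forall n, 0 <= F n) ->
    \sum_(1 <= n < x) F n <= \sum_(1 <= n < 4) F n + \sum_(4 <= n < x) F n.
  move=> F0; have [x4|x4] := leqP 4 x; first by rewrite -big_cat_nat.
  by rewrite [X in _ <= _ + X]big_geq ?(ltnW x4) // addr0 g_sum_le // ltnW.
have C2_ge0 : 0 <= C2 by rewrite addr_ge0 ?mulr_ge0 ?sumr_ge0.
have g1E (F : nat -> R) x : \sum_(1 <= n < x.+1) g1 n * F n
    = \sum_(1 <= q < (x %/ M).+1) (prime q)%:R * F (M * q)%N.
  rewrite -(sum_multiples _ (fun q => (prime q)%:R * F (M * q)%N)) // [RHS]big_mkcond.
  apply: eq_bigr => n _; rewrite /g1; case: ifP => [Mn|_]; last by rewrite mul0r.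
  by rewrite [(M * _)%N]mulnC divnK.
have fg x : \sum_(4 <= n < x) f n <= \sum_(4 <= n < x) g n.
  have [x4|] := leqP x 4; first by rewrite !big_geq.
  case: x => // x; rewrite ltnS => x4.
  apply: (@le_trans _ _ (\sum_(1 <= n < x.+1) f n)); first by apply: g_sum_le => // n; rewrite /f.
  rewrite -(count_uptoE (fun p => prime p && A p)).
  apply: le_trans (_ : (K * count_upto prime (x %/ M) + C1)%:R <= _); first by rewrite ler_nat H.
  rewrite natrD natrM count_uptoE.
  have -> : \sum_(1 <= q < (x %/ M).+1) (prime q)%:R = \sum_(1 <= n < x.+1) g1 n :> R.
    have := g1E (fun=> 1) x; under eq_bigr => n _ do rewrite mulr1.
    by move=> ->; apply: eq_bigr => n _; rewrite mulr1.
  rewrite /g big_split /= -!mulr_sumr.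
  have -> : \sum_(4 <= n < x.+1) (n == 4)%:R = 1 :> R.
    rewrite big_ltn // eqxx big_nat_cond big1 ?addr0 // => n /andP[/andP[n4 _] _].
    by rewrite (gtn_eqF n4).
  have := ler_wpM2l (ler0n R K) (sum4 g1 x.+1 g1_ge0); rewrite mulrDr mulr1 /C2; lra.
have mul_ge0 (F : nat -> R) n : (forall n, 0 <= F n) -> 0 <= F n * w n by move=> F0; rewrite mulr_ge0.
have lnM0 := ln_nat_ge0 R M.
(* For q > M, ln (M q) <= 2 ln q, which is the origin of the factor 2 in the hypothesis on [c]; the
   primes q <= M cost at most ln M each. *)
have upper x : (0 < x)%N -> \sum_(1 <= n < x.+1) g1 n * w n
    <= 2 / M%:R * (ln x%:R + 12) + M%:R * ln M%:R.
  move=> x0; rewrite g1E.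
  pose a q : R := mangoldt R q / q%:R.
  have a0 q : 0 <= a q by rewrite divr_ge0 ?mangoldt_ge0.
  apply: (@le_trans _ _ (2 / M%:R * \sum_(1 <= q < (x %/ M).+1) a q
       + \sum_(1 <= q < (x %/ M).+1) (if (q < M.+1)%N then ln M%:R else 0))).
    rewrite mulr_sumr -big_split /= [leLHS]big_nat_cond [leRHS]big_nat_cond.
    apply: ler_sum => q; rewrite andbT => /andP[q0 _].
    have q0' : 0 < q%:R :> R by rewrite ltr0n.
    have M2 : 0 <= 2 / M%:R * a q by rewrite mulr_ge0 ?a0 // divr_ge0.
    have i0 : 0 <= (if (q < M.+1)%N then ln M%:R else 0) :> R by case: ifP.
    case pq: (prime q); last by rewrite mul0r addr_ge0.
    rewrite mul1r /w /a mangoldt_prime // natrM lnM ?posrE //.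
    have -> : 2 / M%:R * (ln q%:R / q%:R) = (2 * ln q%:R) / (M%:R * q%:R) :> R.
      by field; rewrite !gt_eqF.
    have Mq1 : 1 <= M%:R * q%:R :> R by rewrite -natrM ler1n muln_gt0 M0.
    have Mq0 : 0 < M%:R * q%:R :> R by apply: lt_le_trans Mq1.
    rewrite ler_pdivrMr // mulrDl divfK ?gt_eqF //.
    have lq := ln_nat_ge0 R q.
    case: ifP => [_|/negbT]; last by rewrite -leqNgt => /ltnW/(ler_ln_nat R M0); lra.
    by have := ler_wpM2l lnM0 Mq1; lra.
  apply: lerD.
    rewrite ler_wpM2l ?divr_ge0 //; apply: le_trans (mertens_le R x0).
    by apply: g_sum_le => //; rewrite ltnS leq_div.
  have -> : M%:R * ln M%:R = \sum_(1 <= q < M.+1) ln M%:R :> R.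
    by rewrite sumr_const_nat subn1 mulr_natl.
  rewrite -big_mkcond /= (big_nat_widen _ _ (x %/ M + M).+1) ?ltnS ?leq_addr //.
  rewrite [leRHS](big_nat_widen _ _ (x %/ M + M).+1) ?ltnS ?leq_addl //.
  rewrite big_mkcond [leRHS]big_mkcond; apply: ler_sum => q _ /=.
  by case: (q < M.+1)%N; case: (q < _)%N.
suff : c - 2 * K%:R / M%:R <= 0 by lra.
apply: (@le0_of_ln_bound _ _ (C0 + \sum_(1 <= n < 4) f n * w n
   + K%:R * (2 / M%:R * 12 + M%:R * ln M%:R) + C2 * w 4)) => x x0.
have f_ge0 n : 0 <= f n by rewrite /f.
have h1 : c * ln x%:R - C0 <= \sum_(1 <= n < x.+1) f n * w n.
  apply: le_trans (lowA x x0) _; rewrite big_mkcond; apply: ler_sum => n _.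
  by rewrite /f; case: ifP; rewrite ?mul1r ?mul0r.
have h2 := sum4 (fun n => f n * w n) x.+1 (fun n => mul_ge0 f n f_ge0).
have h3 := abel_compare x.+1 (@ln_div_decr R) w0 fg.
have h4 : \sum_(4 <= n < x.+1) g n * w n <= K%:R * (\sum_(1 <= n < x.+1) g1 n * w n) + C2 * w 4.
  under eq_bigr => n _ do rewrite mulrDl -!mulrA.
  rewrite big_split /= -!mulr_sumr; apply: lerD; rewrite ler_wpM2l //.
    by apply: g_sum_le => // n; apply: mul_ge0.
  have [x4|x4] := leqP x.+1 4; first by rewrite big_geq.
  rewrite big_ltn // eqxx mul1r big_nat_cond big1 ?addr0 // => n /andP[/andP[n4 _] _].
  by rewrite (gtn_eqF n4) mul0r.
have h5 := ler_wpM2l (ler0n R K) (upper x x0).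
have -> : ln x%:R * (c - 2 * K%:R / M%:R) = c * ln x%:R - K%:R * (2 / M%:R * ln x%:R).
  by field; rewrite gt_eqF.
rewrite mulrDr in h5; rewrite -/w in h3.
set u := \sum_(_ <= _ < _) _ in h1 h2 *; set u2 := \sum_(4 <= _ < _) f _ * _ in h2 h3 *.
set u3 := \sum_(4 <= _ < _) _ in h3 h4 *.
move: h1 h2 h3 h4 h5; rewrite !mulrDr; lra.
Qed.

End Counting.

(** * Moduli M with large M / phi(M) *)

Lemma coprime_prod_seq (c : nat) (s : seq nat) :
  all (coprime c) s -> coprime c (\prod_(p <- s) p).
Proof.
elim: s => [|p s IH]; first by rewrite big_nil coprimen1.
by move=> /= /andP[cp /IH cs]; rewrite big_cons coprimeMr cp.
Qed.

Section TotientRatio.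
Variable R : realType.

(* The sum over the integers with all prime factors in s is at most the Euler product over s,
   which is M / phi(M) for M the product of s. *)
Lemma smooth_harmonic_le (s : seq nat) (N : nat) : uniq s -> all prime s ->
  (\sum_(1 <= n < N.+1 | all (mem s) (primes n)) n%:R^-1) * (totient (\prod_(p <- s) p))%:R
    <= (\prod_(p <- s) p)%:R :> R.
Proof.
elim: s => [|p s IH].
  move=> _ _; rewrite big_nil (_ : totient 1 = 1%N) // mulr1.
  case: N => [|N]; first by rewrite big_geq.
  rewrite big_mkcond big_ltn // big_nat_cond big1; first by rewrite /= invr1 addr0.
  move=> n /andP[/andP[n1 _] _]; case: ifP => // /allP/(_ (pdiv n)).
  by rewrite pi_pdiv n1 => /(_ isT).
move=> /= /andP[ps us] /andP[pp als]; have p0 := prime_gt0 pp.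
have p1 : 1 <= p%:R :> R by rewrite ler1n.
have cps : coprime p (\prod_(q <- s) q).
  apply: coprime_prod_seq; apply/allP => q qs; rewrite prime_coprime // dvdn_prime2 ?(allP als q qs) //.
  by apply: contraNneq ps => ->.
rewrite big_cons totient_coprime // totient_prime //.
set S' := \sum_(_ <= _ < _ | _) _.
have {IH} := IH us als; set S := \sum_(_ <= _ < _ | _) _; set phi := (totient _)%:R => IH.
(* Split by divisibility by [p]: the n prime to p belong to [S], and the others are p e with e again
   smooth. Hence (1 - 1/p) S' <= S, which adds one Euler factor. *)
have SS : S' <= S + p%:R^-1 * S'.
  pose h (e : nat) : R := if all (mem (p :: s)) (primes e) then (p * e)%:R^-1 else 0.
  have h0 e : 0 <= h e by rewrite /h; case: ifP => // _; apply: invn_ge0.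
  apply: (@le_trans _ _ (S + \sum_(1 <= n < N.+1 | (p %| n)%N) h (n %/ p)%N)).
    rewrite /S' /S big_mkcond [\sum_(_ <= _ < _ | all (mem s) _) _]big_mkcond.
    rewrite [\sum_(_ <= _ < _ | (_ %| _)%N) _]big_mkcond -big_split /=.
    rewrite [leLHS]big_nat_cond [leRHS]big_nat_cond; apply: ler_sum => n.
    rewrite andbT => /andP[n0 _].
    have i0 : 0 <= (if all (mem s) (primes n) then n%:R^-1 else 0) :> R.
      by case: ifP => // _; apply: invn_ge0.
    case: ifP => al; last by rewrite addr_ge0 //; case: ifP.
    case pn: (p %| n)%N.
      rewrite /h [(p * _)%N]mulnC divnK // [X in _ + X]ifT ?lerDr //.
      apply/allP => q; rewrite mem_primes => /and3P[qp _ qd].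
      by apply: (allP al); rewrite mem_primes qp n0 (dvdn_trans qd) // dvdn_div.
    rewrite addr0 ifT //; apply/allP => q qn; have := allP al q qn; rewrite inE => /orP[/eqP qp|//].
    by move: qn; rewrite qp mem_primes pn !andbF.
  rewrite lerD2l (sum_multiples _ h) //.
  have -> : p%:R^-1 * S' = \sum_(1 <= e < N.+1) h e.
    rewrite mulr_sumr big_mkcond; apply: eq_bigr => e _; rewrite /h.
    by case: ifP => // _; rewrite natrM invfM.
  rewrite [leRHS](@big_cat_nat _ _ _ (N %/ p).+1) ?ltnS ?leq_div //= lerDl.
  by apply: sumr_ge0.
rewrite !natrM -subn1 natrB //.
have : (p%:R - 1) * S' <= p%:R * S.
  have := ler_wpM2l (ler0n R p) SS; rewrite mulrDr mulVKf ?gt_eqF ?ltr0n //; lra.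
move=> /(ler_wpM2r (ler0n R (totient (\prod_(q <- s) q)))); rewrite -/phi.
have := ler_wpM2l (ler0n R p) IH; nra.
Qed.

(** Already the terms n = a j + 1 with 1 <= j <= J suffice, since a j + 1 <= 2 a j. *)
Lemma coprime_harmonic_ge (a J : nat) : (0 < a)%N ->
  (2 * a%:R)^-1 * ln J.+1%:R <= \sum_(1 <= n < (a * J).+2 | coprime a n) n%:R^-1 :> R.
Proof.
move=> a0; apply: le_trans (ler_wpM2l _ (harmonic_ge R J)) _.
  by rewrite invr_ge0 mulr_ge0.
rewrite mulr_sumr; elim: J => [|J IH]; first by rewrite big_geq // sumr_ge0 // => n _; apply: invn_ge0.
rewrite big_nat_recr //= [leRHS](@big_cat_nat _ _ _ (a * J).+2) //=; last first.
  by rewrite !ltnS leq_mul2l leqnSn orbT.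
apply: lerD => //; rewrite big_mkcond big_nat_recr /=; last first.
  by rewrite ltnS -[X in (X < _)%N]muln1 mulnS; lia.
rewrite ifT; last first.
  by rewrite /coprime -[(a * J.+1).+1]addn1 mulnC gcdnMDl gcdn1.
rewrite -[leLHS]add0r; apply: lerD.
  by apply: sumr_ge0 => n _; case: ifP => // _; apply: invn_ge0.
rewrite -invfM lef_pV2 ?posrE ?mulr_gt0 ?ltr0n // -!natrM ler_nat; lia.
Qed.

(** M is the product of the primes up to N not dividing a. Every n <= N coprime to a has its prime
    factors among them, so M / phi(M) dominates the harmonic sum over these n, which exceeds B by
    the choice of J. *)
Lemma totient_ratio (a B : nat) : (0 < a)%N ->
  exists M, [/\ (0 < M)%N, coprime a M & (B * totient M < M)%N].
Proof.
move=> a0; have [J J0 HJ] := ln_unbounded (2 * a%:R * B%:R : R).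
pose N := (a * J).+1; pose s := [seq p <- iota 0 N.+1 | prime p && ~~ (p %| a)%N].
pose M := (\prod_(p <- s) p)%N.
have als : all prime s by apply/allP => p; rewrite mem_filter => /andP[/andP[]].
have M0 : (0 < M)%N by rewrite /M big_seq prodn_cond_gt0 // => p /(allP als)/prime_gt0.
exists M; split=> //.
  apply: coprime_prod_seq; apply/allP => p; rewrite mem_filter => /andP[/andP[pp pa] _].
  by rewrite coprime_sym prime_coprime.
have us : uniq s by rewrite filter_uniq ?iota_uniq.
rewrite -(ltr_nat R) natrM; apply: lt_le_trans (smooth_harmonic_le N us als).
rewrite ltr_pM2r ?ltr0n ?totient_gt0 //.
have a2 : 0 < 2 * a%:R :> R by rewrite mulr_gt0 ?ltr0n.
apply: (@lt_le_trans _ _ ((2 * a%:R)^-1 * ln J.+1%:R)).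
  by rewrite mulrC ltr_pdivlMr // mulrC; apply: lt_le_trans HJ _; apply: ler_ln_nat.
apply: le_trans (coprime_harmonic_ge J a0) _.
rewrite big_mkcond [leRHS]big_mkcond [leLHS]big_nat_cond [leRHS]big_nat_cond.
apply: ler_sum => n; rewrite andbT => /andP[n0 nN].
case: ifP => [can|_]; last by case: ifP => // _; apply: invn_ge0.
rewrite ifT //; apply/allP => p; rewrite mem_primes => /and3P[pp _ pn].
rewrite /= mem_filter pp mem_iota /= (leq_ltn_trans (dvdn_leq n0 pn) nN) andbT.
by rewrite -prime_coprime // (coprime_dvdl pn) // coprime_sym.
Qed.

End TotientRatio.

Local Close Scope ring_scope.

(** * The theorem *)

(** M / phi(M) > 2 K phi(a) is what [prime_counting_gap] requires for the density 1 / phi(a M). The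
    class modulo a M is b modulo a and [M.-1], that is -1, modulo M. The additive term is a function
    of [M] because [M] is chosen only here. *)
Lemma many_primes (R : realType) (a b K : nat) (C1 : nat -> nat) : 0 < a -> coprime a b ->
  exists M x, 0 < M /\ K * count_upto prime (x %/ M) + C1 M
    < count_upto (fun p => [&& prime p, p == b %[mod a] & M %| p.+1]) x.
Proof.
move=> a0 cab; have [M [M0 caM HM]] := totient_ratio R (2 * K * totient a).+1 a0.
have M1 : 1 < M by apply: leq_ltn_trans HM; rewrite muln_gt0 totient_gt0.
have m1 : 1 < a * M by apply: leq_trans M1 _; rewrite leq_pmull.
pose h := chinese a M b M.-1.
have ha : h = b %[mod a] by apply: chinese_modl.
have hM : h = M.-1 %[mod M] by apply: chinese_modr.
have ch : coprime (a * M) h.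
  rewrite coprimeMl -[coprime a h]coprime_modr ha coprime_modr cab /=.
  by rewrite -coprime_modr hM coprime_modr coprimenP.
have [C HC] := mertens_progression R m1 ch.
have Kc : (2 * K%:R / M%:R < (totient (a * M))%:R^-1 :> R)%R.
  have tM : (0 < (totient (a * M))%:R :> R)%R by rewrite ltr0n totient_gt0 muln_gt0 a0.
  rewrite ltr_pdivrMr ?ltr0n // -[ltRHS]mulrC ltr_pdivlMr // -!natrM ltr_nat totient_coprime //.
  by apply: leq_ltn_trans HM; rewrite mulnA leq_mul2r leqnSn orbT.
have [x Hx] := prime_counting_gap (C1 M) M0 HC Kc.
exists M, x; split=> //; apply: leq_trans Hx _.
apply: sub_count => p /andP[-> /eqP pE] /=; apply/andP; split.
  apply/eqP; rewrite -ha -(modn_dvdm p (dvdn_mulr M (dvdnn a))) pE.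
  by rewrite modn_dvdm // dvdn_mulr.
have pM : p = M.-1 %[mod M].
  by rewrite -hM -(modn_dvdm p (dvdn_mull a (dvdnn M))) pE modn_dvdm // dvdn_mull.
by rewrite /dvdn -addn1 -modnDml pM modnDml addn1 prednK // modnn.
Qed.

Lemma logn_prod_seq (I : Type) (s : seq I) (F : I -> nat) q : (forall i, 0 < F i) ->
  logn q (\prod_(i <- s) F i) = \sum_(i <- s) logn q (F i).
Proof.
move=> F0; elim: s => [|i s IH]; first by rewrite !big_nil logn1.
by rewrite !big_cons lognM ?prodn_gt0 // IH.
Qed.

Lemma count_upto_gt (P : pred nat) (N x : nat) :
  count_upto P x <= count_upto (fun p => P p && (N < p)) x + N.
Proof.
rewrite /count_upto; set s := iota 1 x.
have h : count (fun p => p <= N) s <= N.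
  rewrite -size_filter -[X in _ <= X](size_iota 1 N); apply: uniq_leq_size.
    by rewrite filter_uniq ?iota_uniq.
  by move=> p; rewrite mem_filter !mem_iota; lia.
apply: leq_trans (leq_add (leqnn _) h); rewrite -count_predUI.
apply: leq_trans (leq_addr _ _); apply: sub_count => p /= Pp.
by rewrite Pp ltnNge; case: (p <= N).
Qed.

Theorem theorem1 (a b k : nat) :
  0 < a -> 0 < b -> coprime a b -> 2 <= k ->
  (exists t, is_mult_order a b t /\ coprime t k) ->
  forall N : nat, exists n : nat,
    N < n /\ n = b %[mod a] /\ exists m : nat, sigma n = m ^ k.
Proof.
move=> a0 _ cab k2 [t [[t0 bt _] ctk]] N.
have k0 := ltnW k2.
(* The multiple t' of t is prime to k and greater than 1: size 1 modulo t' excludes the empty set. *)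
pose t' := t * k.+1.
have t'1 : 1 < t' by rewrite (leq_trans _ (leq_pmull _ t0)) // ltnW.
have ckt : coprime k t' by rewrite coprimeMr coprime_sym ctk coprimenS.
have [C HC] := zero_sum_mod k2 (ltnW t'1) ckt.
(* In [M + 2], M + 1 allows for the primes of [Q] above [y], and 1 for the successor in [C * r.+1];
   the term [N] pays for the primes up to [N] that are discarded. *)
have [M [x [M0 Hx]]] := many_primes Rdefinitions.R C (fun M => C * (M + 2) + N) a0 cab.
pose y := x %/ M.
(* A prime dividing p + 1, where M divides p + 1 and p <= x, is at most M if it divides M, and
   otherwise at most (p + 1) / M <= y + 1; the bound y + M + 1 covers both cases. *)
pose Q := [seq q <- iota 1 (y + M + 1) | prime q].
pose A p := [&& prime p, p == b %[mod a] & M %| p.+1].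
(* All primes used exceed [N], so every nonempty product of them does. *)
pose s := [seq p <- iota 1 x | A p && (N < p)].
have sizeQ : size Q <= count_upto prime y + M.+1.
  rewrite /Q size_filter -addnA iotaD count_cat leq_add2l addn1.
  by apply: leq_trans (count_size _ _) _; rewrite size_iota.
have sizeS : C * (size Q).+1 <= size s.
  rewrite [X in _ <= X]size_filter -/(count_upto (fun p => A p && (N < p)) x).
  have := count_upto_gt A N x; rewrite -/y -/A mulnDr in Hx *.
  have := leq_mul (leqnn C) sizeQ; rewrite !mulnDr !mulnS; lia.
have sP p : p \in s -> [/\ prime p, p = b %[mod a], M %| p.+1, N < p & p <= x].
  rewrite mem_filter mem_iota => /andP[/andP[/and3P[pp /eqP pb Mp] Np] /andP[_ px]].
  by split=> //; move: px; rewrite add1n ltnS.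
have us : uniq s by rewrite filter_uniq ?iota_uniq.
pose P (i : 'I_(size s)) := nth 0 s i.
have Ps i : P i \in s by rewrite mem_nth.
have [|S zS cS] := HC (size Q) _ (fun (i : 'I_(size s)) l => logn (nth 0 Q l) (P i).+1).
  by rewrite card_ord.
pose n := \prod_(p <- map P (enum S)) p.
have nE : n = \prod_(i in S) P i by rewrite /n big_map big_enum.
exists n; split; [|split].
- have /set0Pn[i iS] : S != set0.
    apply/eqP => S0; move: cS; rewrite S0 cards0 mod0n modn_small //.
  have n0 : 0 < n by rewrite nE prodn_cond_gt0 // => j _; have [/prime_gt0] := sP _ (Ps j).
  have [_ _ _ NP _] := sP _ (Ps i); apply: leq_trans NP _.
  by apply: dvdn_leq => //; rewrite nE (bigD1 i) //= dvdn_mulr.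
- have -> : n = b ^ #|S| %[mod a].
    rewrite nE -prod_nat_const.
    apply: (big_ind2 (fun u v => u = v %[mod a])) => // [u1 v1 u2 v2 E1 E2|i _].
      by rewrite -modnMm E1 E2 modnMm.
    by have [] := sP _ (Ps i).
  have cSt : #|S| = 1 %[mod t].
    by rewrite -(modn_dvdm #|S| (dvdn_mulr k.+1 (dvdnn t))) -/t' cS modn_dvdm // dvdn_mulr.
  have bmod j : b ^ j = b ^ (j %% t) %[mod a].
    rewrite {1}(divn_eq j t) expnD mulnC [_ * t]mulnC expnM.
    by rewrite -modnMmr -modnXm bt modnXm exp1n modnMmr muln1.
  by rewrite bmod cSt -bmod expn1.
rewrite sigma_prod_primes; last first.
- by apply/allP => p /mapP[i _ ->]; have [] := sP _ (Ps i).
- rewrite map_inj_uniq ?enum_uniq // => i j /eqP.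
  by rewrite nth_uniq // => /eqP/val_inj.
rewrite big_map; apply: perfect_power; first exact: prodn_gt0.
move=> q pq; rewrite logn_prod_seq // big_enum /=.
have [qQ|qQ] := boolP (q \in Q).
  have qi : index q Q < size Q by rewrite index_mem.
  by have := forallP zS (Ordinal qi); rewrite /= nth_index.
rewrite big1 // => i _; apply/eqP; rewrite -leqn0 leqNgt logn_gt0 mem_primes pq /=.
apply: contra qQ => qP; have [_ _ MP _ Px] := sP _ (Ps i).
rewrite mem_filter pq mem_iota prime_gt0 //= add1n addn1 ltnS.
move: qP; rewrite -(divnK MP) Euclid_dvdM // => /orP[] /dvdn_leq; last first.
  by move=> /(_ M0) qM; rewrite -addnS (leq_trans qM) // -addSnnS leq_addl.
have e0 : 0 < (P i).+1 %/ M by rewrite divn_gt0 // dvdn_leq.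
move=> /(_ e0) qe; apply: leq_trans qe _.
apply: leq_trans (leq_div2r M (Px : (P i).+1 <= x.+1)) _.
rewrite divnS // -/y -[(y + M).+1]add1n; apply: leq_add (leq_b1 _) (leq_addr _ _).
Qed.
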